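(* The following statements are equivalent for any real normed vector space $V$ (regarded as a metric space with the metric induced by its norm). (i) $V$ is tractable. (ii) $V$ is finite dimensional and can be isometrically embedded (as a metric space) into $L_1$. (iii) $V$ is isometrically isomorphic to a finite-dimensional vector subspace of $L_1$. (iv) $V$ is finite dimensional, positive definite, and all closed balls in it have finite magnitude. (v) $V$ is finite dimensional, positive definite, and there exists a closed ball (with positive radius) in it with finite magnitude.
   Context: $L_1$ denotes $L_1([0,1],\mathbb{R})$, the space of equivalence classes of integrable functions $[0,1]\to\mathbb{R}$ with the usual integral $1$-norm. For a finite metric space $F=\{a_1,\dots,a_n\}$ (distinct points) with metric $d$, its similarity matrix is $Z_F\in\mathbb{R}^{n\times n}$ with $(Z_F)_{ij}=e^{-d(a_i,a_j)}$. A metric space is positive definite if every finite subspace has a positive definite similarity matrix. For a finite positive definite space $F$, its magnitude $\mathrm{mag}(F)$ is the sum of all entries of $Z_F^{-1}$ (so $\mathrm{mag}(\emptyset)=0$). For a compact positive definite space $K$, $\mathrm{mag}(K):=\sup\{\mathrm{mag}(F) : F\subseteq K \text{ finite}\}\in[0,\infty]$; this agrees with the previous definition when $K$ is finite. A metric space $M$ is tractable if it is positive definite and, for every $x\in M$ and real $r>0$, the closed ball in $M$ with center $x$ and radius $r$ is compact and has finite magnitude. *)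

(* Defs.v *)
From HB Require Import structures.
From mathcomp Require Import all_boot all_order all_algebra finmap.
From mathcomp Require Import all_classical all_reals all_analysis.
From mathcomp Require Import measurable_realfun metric_structure.

Set Implicit Arguments.
Unset Strict Implicit.
Unset Printing Implicit Defensive.

Import Order.TTheory GRing.Theory Num.Theory.
Import numFieldNormedType.Exports.

Local Open Scope classical_set_scope.
Local Open Scope ring_scope.

(* The library's [LspaceType1 mu] (a.e.-classes of measurable functions with
   finite 1-norm) carries no algebraic structure; the operations are those of
   [LfunType] transported along [L1class], and the norm is the integral of
   the absolute value. *)
Section L1space.
Context d (T : measurableType d) (R : realType).
Variable mu : {measure set T -> \bar R}.

Local Notation lfun := (LfunType mu (@lexx _ _ 1%E)).
Local Notation mfunq := {mfun_ mu, T >-> measurableTypeR R}.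

Definition L1space : Type := LspaceType1 mu.
HB.instance Definition _ := gen_eqMixin L1space.
HB.instance Definition _ := gen_choiceMixin L1space.

Definition L1fun (x : L1space) : T -> R := (x : LspaceType1 mu) : mfunq.

Fact measurableTypeR_fun (f : {mfun T >-> R}) :
  measurable_fun setT (f : T -> measurableTypeR R).
Proof. exact: (@measurable_funPT _ _ _ _ f). Qed.

(* [R] and [measurableTypeR R] have the same measurable sets but different
   displays. *)
Definition to_measurableTypeR (f : {mfun T >-> R}) :
    {mfun T >-> measurableTypeR R} :=
  MeasurableFun.Pack (MeasurableFun.Class
    (isMeasurableFun.Build _ _ _ (measurableTypeR R) _
      (measurableTypeR_fun f))).

Definition mfun_class (f : {mfun T >-> R}) : mfunq :=
  (\pi_(mfunq) (to_measurableTypeR f))%qT.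

Lemma mfun_class_ae (f : {mfun T >-> R}) :
  (mfun_class f : T -> R) = f %[ae mu].
Proof.
have : repr (mfun_class f) == to_measurableTypeR f %[mod mfunq]%qT.
  by rewrite reprK.
by rewrite eqmodE => /asboolP.
Qed.

Lemma measurable_mfunq (q : mfunq) : measurable_fun setT (q : T -> R).
Proof. exact: (@measurable_funPT _ _ _ _ (repr q)). Qed.

Lemma Lnorm1_ae (f g : T -> R) :
  measurable_fun setT f -> measurable_fun setT g -> f = g %[ae mu] ->
  ('N[mu]_1[EFin \o f] = 'N[mu]_1[EFin \o g])%E.
Proof.
move=> mf mg fg; rewrite !Lnorm1; apply: ge0_ae_eq_integral => //=.
- by apply/measurable_EFinP; exact: measurableT_comp.
- by apply/measurable_EFinP; exact: measurableT_comp.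
- by apply: filterS fg => t /(_ I) + _ => ->.
Qed.

Fact L1class_subproof (f : lfun) : finite_norm mu 1 (mfun_class f).
Proof.
rewrite /finite_norm.
have -> : ('N[mu]_1[EFin \o mfun_class f] = 'N[mu]_1[EFin \o f])%E.
  apply: Lnorm1_ae => //; first exact: measurable_mfunq.
  exact: mfun_class_ae.
exact: Lfunction_finite.
Qed.

Definition L1class (f : lfun) : L1space :=
  LebesgueSpace.Pack (LebesgueSpace.Class
    (isFinLebesgue.Build _ _ _ mu _ (@lexx _ _ 1%E) _ (L1class_subproof f))).

Lemma L1class_ae (f : lfun) : L1fun (L1class f) = f %[ae mu].
Proof. exact: mfun_class_ae. Qed.

Lemma L1eqP (x y : L1space) : x = y <-> L1fun x = L1fun y %[ae mu].
Proof.
split=> [->|]; first exact: ae_eq_refl.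
case: x => x [[hx]]; case: y => y [[hy]] xy.
have exy : x = y.
  by apply/eqP; rewrite -(reprK x) -(reprK y) eqmodE; exact/asboolP.
case: _ / exy in hy xy *.
by rewrite (Prop_irrelevance hx hy).
Qed.

Fact L1rep_subproof (x : L1space) : L1fun x \in Lfun mu 1.
Proof.
apply/andP; split; apply/mem_set; first exact: measurable_mfunq.
exact: (@Lebesgue_finite _ _ _ _ _ _ x).
Qed.

Definition L1rep (x : L1space) : lfun := Lfun_Sub _ (L1rep_subproof x).

Lemma L1classP (f g : lfun) :
  L1class f = L1class g <-> (f : T -> R) = g %[ae mu].
Proof.
rewrite L1eqP; split => h.
  apply: ae_eq_trans (L1class_ae g); apply: ae_eq_trans h.
  exact/ae_eq_sym/L1class_ae.
apply: (ae_eq_trans (L1class_ae f)); apply: (ae_eq_trans h).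
exact/ae_eq_sym/L1class_ae.
Qed.

Lemma L1rep_ae (f : lfun) : (L1rep (L1class f) : T -> R) = f %[ae mu].
Proof. exact: L1class_ae. Qed.

Lemma L1repK x : L1class (L1rep x) = x.
Proof. by rewrite L1eqP; exact: L1class_ae. Qed.

Definition L1zero : L1space := L1class 0.
Definition L1opp x : L1space := L1class (- L1rep x).
Definition L1add x y : L1space := L1class (L1rep x + L1rep y).
Definition L1scale (a : R) x : L1space := L1class (a *: L1rep x).
Definition L1norm (x : L1space) : R := (\int[mu]_t `|L1fun x t|)%R.

Lemma LfunNE (f : lfun) t : (- f) t = - f t. Proof. by []. Qed.
Lemma LfunDE (f g : lfun) t : (f + g) t = f t + g t. Proof. by []. Qed.
Lemma LfunZE a (f : lfun) t : (a *: f) t = a * f t. Proof. by []. Qed.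

Lemma L1opp_class f : L1opp (L1class f) = L1class (- f).
Proof.
by apply/L1classP; apply: filterS (L1rep_ae f) => t h Dt; rewrite !LfunNE h.
Qed.

Lemma L1add_class f g : L1add (L1class f) (L1class g) = L1class (f + g).
Proof.
apply/L1classP; apply: filterS2 (L1rep_ae f) (L1rep_ae g) => t hf hg Dt.
by rewrite !LfunDE hf// hg.
Qed.

Lemma L1scale_class a f : L1scale a (L1class f) = L1class (a *: f).
Proof.
by apply/L1classP; apply: filterS (L1rep_ae f) => t h Dt; rewrite !LfunZE h.
Qed.

Fact L1addA : associative L1add.
Proof.
by move=> x y z; rewrite -(L1repK x) -(L1repK y) -(L1repK z) !L1add_class addrA.
Qed.

Fact L1addC : commutative L1add.
Proof. by move=> x y; rewrite -(L1repK x) -(L1repK y) !L1add_class addrC. Qed.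

Fact L1add0 : left_id L1zero L1add.
Proof. by move=> x; rewrite -(L1repK x) L1add_class add0r. Qed.

Fact L1addN : left_inverse L1zero L1opp L1add.
Proof. by move=> x; rewrite -(L1repK x) L1opp_class L1add_class addNr. Qed.

HB.instance Definition _ :=
  GRing.isZmodule.Build L1space L1addA L1addC L1add0 L1addN.

Lemma L1classD f g : L1class (f + g) = L1class f + L1class g.
Proof. exact/esym/L1add_class. Qed.

Lemma L1classN f : L1class (- f) = - L1class f.
Proof. exact/esym/L1opp_class. Qed.

Fact L1scaleA a b x : L1scale a (L1scale b x) = L1scale (a * b) x.
Proof. by rewrite -(L1repK x) !L1scale_class scalerA. Qed.

Fact L1scale1 : left_id 1 L1scale.
Proof. by move=> x; rewrite -(L1repK x) L1scale_class scale1r. Qed.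

Fact L1scaleDr : right_distributive L1scale +%R.
Proof.
move=> a x y; rewrite -(L1repK x) -(L1repK y).
by rewrite -L1classD !L1scale_class -L1classD scalerDr.
Qed.

Fact L1scaleDl x : {morph L1scale^~ x : a b / a + b}.
Proof.
by move=> a b /=; rewrite -(L1repK x) !L1scale_class -L1classD scalerDl.
Qed.

HB.instance Definition _ := GRing.Zmodule_isLmodule.Build R L1space
  L1scaleA L1scale1 L1scaleDr L1scaleDl.

Lemma L1classZ a f : L1class (a *: f) = a *: L1class f.
Proof. exact/esym/L1scale_class. Qed.

Lemma L1normE x : L1norm x = fine ('N[mu]_1[EFin \o L1rep x])%E.
Proof. by rewrite /L1norm /Rintegral Lnorm1. Qed.

Lemma L1norm_class f : L1norm (L1class f) = fine ('N[mu]_1[EFin \o f])%E.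
Proof. by rewrite L1normE; congr fine; apply: Lnorm1_ae => //; exact: L1rep_ae. Qed.

Fact L1norm_triangle x y : L1norm (x + y) <= L1norm x + L1norm y.
Proof.
rewrite -(L1repK x) -(L1repK y) -L1classD !L1norm_class.
exact: ler_LnormD.
Qed.

Fact L1normZ a x : L1norm (a *: x) = `|a| * L1norm x.
Proof.
rewrite -(L1repK x) -L1classZ !L1norm_class.
apply: EFin_inj; rewrite EFinM !finite_norm_fine.
exact: LnormZ.
Qed.

Fact L1norm0_eq0 x : L1norm x = 0 -> x = 0.
Proof.
rewrite L1normE => /fine_Lnormr_eq0 h.
by rewrite -(L1repK x); apply/L1classP.
Qed.

HB.instance Definition _ := Lmodule_isNormed.Build R L1space
  L1norm_triangle L1normZ L1norm0_eq0.

End L1space.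

(* Functions on [0, 1] are represented by functions on the whole line modulo
   a.e. equality on [0, 1]. *)
Definition lebesgue01 {R : realType} : set (measurableTypeR R) -> \bar R :=
  mrestr lebesgue_measure (measurable_itv `[(0 : R), 1]).
HB.instance Definition _ (R : realType) := Measure.on (@lebesgue01 R).

Definition L1 (R : realType) : Type := L1space (@lebesgue01 R).
HB.instance Definition _ (R : realType) := NormedModule.on (L1 R).

Definition normed_metric (R : realType) (V : normedModType R) : Type := V.

Section normed_metric.
Context (R : realType) (V : normedModType R).

HB.instance Definition _ := PseudoPointedMetric.on (normed_metric V).

Definition normed_dist (x y : normed_metric V) : R := `|(x : V) - (y : V)|.

Fact normed_dist_ge0 x y : 0 <= normed_dist x y.
Proof. exact: normr_ge0. Qed.

Fact normed_dist_positivity x y : normed_dist x y = 0 -> x = y.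
Proof. by move=> /normr0_eq0 /eqP; rewrite subr_eq0 => /eqP. Qed.

Fact normed_dist_ball x e : ball x e = [set y | normed_dist x y < e].
Proof. exact: (esym (congr1 (fun b => b x e) (@ball_normE R V))). Qed.

HB.instance Definition _ := @PseudoMetric_isMetric.Build R (normed_metric V)
  normed_dist normed_dist_ge0 normed_dist_positivity normed_dist_ball.

End normed_metric.

Section magnitude.
Context (R : realType).

Definition posdefmx n (A : 'M[R]_n) : Prop :=
  A^T = A /\ forall v : 'cV[R]_n, v != 0 -> 0 < (v^T *m A *m v) ord0 ord0.

Variable M : metricType R.

Definition similarity_mx (F : {fset M}) : 'M[R]_#|{: F}| :=
  \matrix_(i, j) expR (- mdist (val (enum_val i)) (val (enum_val j))).

Definition positive_definite : Prop :=
  forall F : {fset M}, posdefmx (similarity_mx F).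

Definition fset_magnitude (F : {fset M}) : R :=
  \sum_i \sum_j invmx (similarity_mx F) i j.

(* Only meaningful for a compact subset of a positive definite space. *)
Definition magnitude (K : set M) : \bar R :=
  ereal_sup
    [set (fset_magnitude F)%:E | F in [set F : {fset M} | [set` F] `<=` K]].

(* Not the library's [closed_ball], which is the closure of the open ball and
   may be smaller in a general metric space. *)
Definition closed_mball (x : M) (r : R) : set M := [set y | mdist x y <= r].

Definition tractable : Prop :=
  positive_definite /\
  forall (x : M) (r : R), 0 < r ->
    compact (closed_mball x r) /\ (magnitude (closed_mball x r) < +oo)%E.

End magnitude.

Definition isometric_embedding (R : realType) (M N : metricType R)
    (f : M -> N) : Prop :=
  forall x y, mdist (f x) (f y) = mdist x y.

Section finite_dimension.
Context (R : realType) (U : lmodType R).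

Definition is_subspace (W : set U) : Prop :=
  W 0 /\ forall (a : R) u v, W u -> W v -> W (a *: u + v).

Definition finite_dimensional (W : set U) : Prop :=
  exists n (b : 'I_n -> U), (forall i, W (b i)) /\
    forall u, W u -> exists c : 'I_n -> R, u = \sum_i c i *: b i.

End finite_dimension.

(* Main.v *)
Require Import Defs.
From HB Require Import structures.
From mathcomp Require Import all_boot all_order all_algebra finmap.
From mathcomp Require Import all_classical all_reals all_analysis.
From mathcomp Require Import measurable_realfun metric_structure.
From mathcomp Require Import ring lra zify.
Set Implicit Arguments.
Unset Strict Implicit.
Unset Printing Implicit Defensive.
Import Order.TTheory GRing.Theory Num.Theory.
Import numFieldNormedType.Exports.
Local Open Scope classical_set_scope.
Local Open Scope ring_scope.

(** The heart of the matter is one implication: a finite-dimensional normed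
    space of negative type, that is, one for which [exp (- |x - y|)] is a
    positive semidefinite kernel, has a linear isometric embedding into L1
    ([negative_type_embeds]). Every condition of the theorem gives negative
    type, either through positive definiteness or through an embedding into L1,
    and once a linear embedding is available everything else follows from the
    geometry of L1.

    That geometry is elementary. For reals in [-r, r] the kernel
    [2 * r - |a - b|] is an average of rank-one kernels, so multiplying a
    positive semidefinite kernel by it preserves positivity. Integrating over
    [0, 1], the same holds for [B - |f - g|] on any family of functions
    dominated by an integrable function of integral [B / 2]
    ([psd_multiplier_L1dist]). By the exponential series
    [exp (- |f - g|) - exp (- B)] is then positive semidefinite, which at once
    gives negative type and bounds the magnitude of the family by [exp B]
    ([fset_magnitude_le]). Strict definiteness comes from comparing
    [exp (- d)] with [exp (- m d)] for large [m] ([quad_exp_gt0]). In a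
    finite-dimensional subspace of L1 a ball is dominated, hence has finite
    magnitude ([ball_magnitude_lty]).

    For the embedding, let [N] be the norm in coordinates. Fejer's positive
    kernel on the integer lattice, applied to [exp (- t N)] with small [t],
    expresses [N] up to a small error as a finite positive combination of
    functions [1 - cos <x, theta>] ([seminorm_approx]). Since [N] is
    homogeneous, it may be replaced by the average of [N (k x) / k] over odd
    [k <= 2 L] with weights [1 / k]; this turns [1 - cos s] into the sum of
    [(1 - cos (k s)) / k ^ 2], a partial Fourier sum of a triangle wave, which
    is [c |s|] for small [s] ([triangle_wave]). All errors stay bounded while
    the total weight grows like [log L], so [N] is a limit of functions
    [x |-> sum of w_j |<x, xi_j>|] with points [xi_j] in a fixed cube and total
    mass one ([spectral_approximation]). The limit of these measures along an
    ultrafilter is a finitely additive mean ([ultra_mean]), and every mean on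
    bounded functions is realized by functions on [0, 1]: successive yes-or-no
    questions about the point cut [0, 1) into nested intervals whose lengths
    are the masses of the answers ([mean_realization]).

    The remaining topology, namely Riesz's theorem that compact balls force
    finite dimension and its converse, also rests on limits along ultrafilters,
    applied to coefficients that are bounded by a multiple of the norm
    ([coef_bound_exists]). *)

(** * Positive semidefinite kernels *)

Lemma cvgr_sum (R : realFieldType) (I : finType) (T : Type) (F : set_system T)
    (FF : Filter F) (f : I -> T -> R) (a : I -> R) :
  (forall i, f i t @[t --> F] --> a i) ->
  \sum_i f i t @[t --> F] --> \sum_i a i.
Proof.
move=> fa; apply: (@cvg_big _ _ +%R 0) => //.
by move=> x; exact: add_continuous.
Qed.

(** Allowing repeated points in the family spares every later application a
    discussion of whether the points in play are distinct. *)
Definition psd_kernel (R : realType) (T : Type) (K : T -> T -> R) : Prop :=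
  forall (I : finType) (x : I -> T) (v : I -> R),
    0 <= \sum_i \sum_j v i * v j * K (x i) (x j).

Section psd_kernel.
Context (R : realType) (T : Type).
Implicit Types (K H G : T -> T -> R).

Lemma eq_psd_kernel K H : (forall x y, K x y = H x y) ->
  psd_kernel K -> psd_kernel H.
Proof.
move=> KH hK I x v; under eq_bigr do under eq_bigr do rewrite -KH.
exact: hK.
Qed.

Lemma psd_kernel1 : psd_kernel (fun _ _ : T => 1 : R).
Proof.
move=> I x v; under eq_bigr do under eq_bigr do rewrite mulr1.
by under eq_bigr do rewrite -mulr_sumr; rewrite -mulr_suml -expr2 sqr_ge0.
Qed.

Lemma psd_kernelD K H : psd_kernel K -> psd_kernel H ->
  psd_kernel (fun x y => K x y + H x y).
Proof.
move=> hK hH I x v; under eq_bigr do under eq_bigr do rewrite mulrDr.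
by under eq_bigr do rewrite big_split; rewrite big_split /= addr_ge0.
Qed.

Lemma psd_kernelZ (c : R) K : 0 <= c -> psd_kernel K ->
  psd_kernel (fun x y => c * K x y).
Proof.
move=> c0 hK I x v; under eq_bigr do under eq_bigr do rewrite mulrCA.
by under eq_bigr do rewrite -mulr_sumr; rewrite -mulr_sumr mulr_ge0.
Qed.

Lemma psd_kernel0 : psd_kernel (fun _ _ : T => 0 : R).
Proof.
by move=> I x v; rewrite big1// => i _; rewrite big1// => j _; rewrite mulr0.
Qed.

Lemma psd_kernel_sum (J : Type) (s : seq J) (P : pred J)
    (F : J -> T -> T -> R) :
  (forall k, P k -> psd_kernel (F k)) ->
  psd_kernel (fun x y => \sum_(k <- s | P k) F k x y).
Proof.
move=> hF; elim: s => [|k s IHs].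
  by apply: eq_psd_kernel psd_kernel0 => x y; rewrite big_nil.
case Pk : (P k).
  by apply: eq_psd_kernel (psd_kernelD (hF k Pk) IHs) => x y; rewrite big_cons Pk.
by apply: eq_psd_kernel IHs => x y; rewrite big_cons Pk.
Qed.

Lemma cvg_quad_form (F : nat -> T -> T -> R) K (I : finType) (x : I -> T)
    (v : I -> R) :
  (forall i j, F n (x i) (x j) @[n --> \oo] --> K (x i) (x j)) ->
  \sum_i \sum_j v i * v j * F n (x i) (x j) @[n --> \oo] -->
    \sum_i \sum_j v i * v j * K (x i) (x j).
Proof.
move=> FK; apply: cvgr_sum => i; apply: cvgr_sum => j.
by apply: cvgM; [exact: cvg_cst|exact: FK].
Qed.

Lemma psd_kernel_cvg (F : nat -> T -> T -> R) K :
  (\forall n \near \oo, psd_kernel (F n)) ->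
  (forall x y, F n x y @[n --> \oo] --> K x y) -> psd_kernel K.
Proof.
move=> hF FK I x v.
have /cvgr_to_ge := @cvg_quad_form F K I x v (fun i j => FK (x i) (x j)).
by apply; apply: filterS hF => n; exact.
Qed.

(** [min] is the kernel $\int_0^\infty 1_{s<a}1_{s<b}\,ds$, an average of
    rank-one kernels; the induction peels off the layer below the least
    positive value. *)
Lemma psd_kernel_min (a : T -> R) H : (forall x, 0 <= a x) ->
  psd_kernel H -> psd_kernel (fun x y => Num.min (a x) (a y) * H x y).
Proof.
move=> a0 hH I x v.
suff layer (k : nat) (b : I -> R) : (#|[pred i | (0 < b i)%R]| <= k)%N ->
    (forall i, 0 <= b i) ->
    0 <= \sum_i \sum_j v i * v j * (Num.min (b i) (b j) * H (x i) (x j)).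
  by apply: (layer _ (a \o x) (leqnn _)) => i; exact: a0.
have zero (c : I -> R) : (forall i, 0 <= c i) -> (forall i, ~~ (0 < c i)) ->
    0 <= \sum_i \sum_j v i * v j * (Num.min (c i) (c j) * H (x i) (x j)).
  move=> c0 c00; rewrite big1// => i _; rewrite big1// => j _.
  have c_eq0 i' : c i' = 0 by apply/le_anti; rewrite c0 andbT leNgt c00.
  by rewrite !c_eq0 minxx mul0r mulr0.
elim: k b => [|k IHk] b cb b0.
  by apply: zero => // i; move: cb; rewrite leqn0 => /eqP /card0_eq /(_ i)/negbT.
have [/existsP[i0 bi0]|] := boolP [exists i, 0 < b i]; last first.
  by rewrite negb_exists => /forallP h; exact: zero.
case: (@arg_minP _ _ I i0 (fun i => 0 < b i) b bi0) => m bm hm.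
pose b' i := if 0 < b i then b i - b m else 0.
pose w i := if 0 < b i then v i else 0.
have b'0 i : 0 <= b' i.
  by rewrite /b'; case: ifPn => // bi; rewrite subr_ge0; exact: hm.
have split_min i j : v i * v j * (Num.min (b i) (b j) * H (x i) (x j)) =
    b m * (w i * w j * H (x i) (x j)) +
    v i * v j * (Num.min (b' i) (b' j) * H (x i) (x j)).
  rewrite /w /b'; case: (ltP 0 (b i)) => [bi|bi]; last first.
    have -> : b i = 0 by apply/le_anti; rewrite b0 bi.
    rewrite (min_idPl (b0 _)) !mul0r mulr0 add0r (min_idPl _) ?mul0r ?mulr0//.
    by case: ltP => // bj; rewrite subr_ge0; exact: hm.
  case: (ltP 0 (b j)) => [bj|bj]; last first.
    have -> : b j = 0 by apply/le_anti; rewrite b0 bj.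
    rewrite (min_idPr (b0 _)) !mulr0 !mul0r !mulr0 add0r (min_idPr _).
      by rewrite mul0r mulr0.
    by rewrite subr_ge0; exact: hm.
  have -> : Num.min (b i) (b j) = b m + Num.min (b i - b m) (b j - b m).
    by rewrite addr_minr [b m + _]addrC subrK [b m + (_ - _)]addrC subrK.
  ring.
under eq_bigr do under eq_bigr do rewrite split_min.
under eq_bigr do rewrite big_split /= -mulr_sumr.
rewrite big_split /= -mulr_sumr addr_ge0//.
  by rewrite mulr_ge0//; exact: hH.
apply: IHk => //; rewrite -ltnS (leq_trans _ cb)//; apply: proper_card.
apply/properP; split.
  apply/fintype.subsetP => i; rewrite !inE /b'; case: ifPn => //.
  by move=> _; rewrite ltxx.
by exists m; rewrite !inE// /b' bm subrr ltxx.
Qed.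

(** Twice the radius minus the distance is the sum of the two [min] kernels
    measuring from the two ends of the interval. *)
Lemma psd_kernel_absdist (a : T -> R) (r : R) H : (forall x, `|a x| <= r) ->
  psd_kernel H -> psd_kernel (fun x y => (2 * r - `|a x - a y|) * H x y).
Proof.
move=> ar hH.
have [h1 h2] : (forall x, 0 <= r + a x) /\ (forall x, 0 <= r - a x).
  split=> x; have := ar x; rewrite ler_norml => /andP[]; lra.
apply: eq_psd_kernel (psd_kernelD (psd_kernel_min h1 hH) (psd_kernel_min h2 hH)).
move=> x y; rewrite -mulrDl; congr (_ * _).
case: (lerP (a x) (a y)) => axy.
  have -> : Num.min (r + a x) (r + a y) = r + a x by apply/min_idPl; lra.
  have -> : Num.min (r - a x) (r - a y) = r - a y by apply/min_idPr; lra.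
  lra.
have -> : Num.min (r + a x) (r + a y) = r + a y by apply/min_idPr; lra.
have -> : Num.min (r - a x) (r - a y) = r - a x by apply/min_idPl; lra.
lra.
Qed.

(** Multiplication by [G] preserving positivity is the form in which the Schur
    product theorem is available for the kernels at hand without factoring
    matrices. *)
Definition psd_multiplier G := forall H, psd_kernel H ->
  psd_kernel (fun x y => G x y * H x y).

Lemma psd_multiplierX G k : psd_multiplier G ->
  psd_kernel (fun x y => G x y ^+ k).
Proof.
move=> hG; elim: k => [|k IHk]; first exact: psd_kernel1.
by apply: eq_psd_kernel (hG _ IHk) => x y; rewrite exprS.
Qed.

(** The exponential series with one term left out still has positive
    semidefinite terms. Leaving out the constant term bounds the magnitude;
    leaving out an arbitrary one isolates the Hadamard powers of [G]. *)
Lemma psd_kernel_exp_sub G k : psd_multiplier G ->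
  psd_kernel (fun x y => expR (G x y) - G x y ^+ k / k`!%:R).
Proof.
move=> hG.
pose F n x y := \sum_(0 <= i < n | i != k) exp_coeff (G x y) i.
apply: (@psd_kernel_cvg F); last first.
  move=> x y; apply: (@cvg_trans _ ((series (exp_coeff (G x y)) n -
      G x y ^+ k / k`!%:R) @[n --> \oo])).
    apply: near_eq_cvg; near=> n.
    have kn : (k < n)%N by near: n; exact: nbhs_infty_gt.
    rewrite /F /series /= [X in X - _](bigD1_seq k) /= ?iota_uniq//.
      by rewrite /exp_coeff /= addrAC subrr add0r.
    by rewrite mem_index_iota.
  apply: cvgB; last exact: cvg_cst.
  exact: is_cvg_series_exp_coeff.
near=> n; apply: psd_kernel_sum => i _.
apply: (@eq_psd_kernel (fun x y => (i`!%:R)^-1 * G x y ^+ i)).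
  by move=> x y; rewrite mulrC.
by apply: psd_kernelZ; [rewrite invr_ge0|exact: psd_multiplierX].
Unshelve. all: by end_near. Qed.

Lemma psd_kernel_exp G : psd_multiplier G ->
  psd_kernel (fun x y => expR (G x y)).
Proof.
move=> hG; apply: eq_psd_kernel
  (psd_kernelD (psd_kernel_exp_sub 0 hG) psd_kernel1) => x y.
by rewrite expr0 divr1 subrK.
Qed.

Lemma psd_kernel_expN (B : R) (d : T -> T -> R) :
  psd_multiplier (fun x y => B - d x y) -> psd_kernel (fun x y => expR (- d x y)).
Proof.
move=> hG; apply: eq_psd_kernel
  (psd_kernelZ (expR_ge0 (- B)) (psd_kernel_exp hG)) => x y.
by rewrite -expRD addrA addNr add0r.
Qed.

(** Since [exp G - 1] is positive semidefinite, the all-ones form is bounded by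
    [exp B] times the similarity form; this is what bounds the magnitude. *)
Lemma sqr_sum_le_quad_exp (B : R) (d : T -> T -> R) (I : finType) (x : I -> T)
    (v : I -> R) :
  psd_multiplier (fun x y => B - d x y) ->
  (\sum_i v i) ^+ 2 <= expR B * \sum_i \sum_j v i * v j * expR (- d (x i) (x j)).
Proof.
move=> hG; have := psd_kernel_exp_sub 0 hG x v.
under eq_bigr do under eq_bigr do rewrite expr0 divr1 mulrBr mulr1.
under eq_bigr do rewrite sumrB; rewrite sumrB subr_ge0.
under eq_bigr do rewrite -mulr_sumr; rewrite -mulr_suml -expr2.
move=> /le_trans; apply; rewrite mulr_sumr; apply: ler_sum => i _.
rewrite mulr_sumr; apply: ler_sum => j _.
by rewrite mulrCA -expRD.
Qed.

(** A null vector of [exp (- d)] annihilates every Hadamard power of [B - d],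
    hence is null for [exp (- m d)] for all [m]; but these matrices tend to the
    identity. *)
Lemma quad_exp_gt0 (B : R) (d : T -> T -> R) (I : finType) (x : I -> T)
    (v : I -> R) :
  psd_multiplier (fun x y => B - d x y) ->
  (forall i, d (x i) (x i) = 0) ->
  (forall i j, i != j -> 0 < d (x i) (x j)) ->
  (exists i, v i != 0) ->
  0 < \sum_i \sum_j v i * v j * expR (- d (x i) (x j)).
Proof.
move=> hG dxx dxy [i0 vi0].
rewrite lt_neqAle (psd_kernel_expN hG) andbT; apply/eqP => /esym Q0.
(* A vanishing sum of nonnegative terms: each Hadamard power is annihilated. *)
pose q k := \sum_i \sum_j v i * v j * (B - d (x i) (x j)) ^+ k.
have QB : \sum_i \sum_j v i * v j * expR (B - d (x i) (x j)) = 0.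
  transitivity (expR B * 0); last by rewrite mulr0.
  rewrite -[X in _ = _ * X]Q0 mulr_sumr; apply: eq_bigr => i _; rewrite mulr_sumr.
  by apply: eq_bigr => j _; rewrite expRD mulrCA.
have q0 k : q k = 0.
  apply/le_anti; rewrite (psd_multiplierX k hG) andbT.
  have := psd_kernel_exp_sub k hG x v.
  under eq_bigr do under eq_bigr do rewrite mulrBr mulrA.
  under eq_bigr do rewrite sumrB -mulr_suml.
  rewrite sumrB QB sub0r -mulr_suml -/(q k) oppr_ge0.
  by rewrite pmulr_lle0 ?invr_gt0 ?ltr0n ?fact_gt0.
have Qm m : \sum_i \sum_j v i * v j * expR (- (m%:R * d (x i) (x j))) = 0.
  have Em : \sum_i \sum_j v i * v j * expR (m%:R * (B - d (x i) (x j))) = 0.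
    apply: (@cvg_unique _ (@Rhausdorff R)
      ((\sum_i \sum_j v i * v j *
          series (exp_coeff (m%:R * (B - d (x i) (x j)))) n) @[n --> \oo])).
      apply: cvgr_sum => i; apply: cvgr_sum => j.
      apply: cvgM; first exact: cvg_cst.
      exact: is_cvg_series_exp_coeff.
    rewrite (_ : (fun n => _) = fun=> 0); first exact: cvg_cst.
    apply/funext => n; rewrite /series /=.
    under eq_bigr do under eq_bigr do rewrite mulr_sumr.
    under eq_bigr do rewrite exchange_big /=.
    rewrite exchange_big /=; apply: big1 => k _.
    transitivity (m%:R ^+ k / k`!%:R * q k); last by rewrite q0 mulr0.
    rewrite mulr_sumr; apply: eq_bigr => i _; rewrite mulr_sumr.
    by apply: eq_bigr => j _; rewrite /exp_coeff /= exprMn; ring.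
  transitivity (expR (- (m%:R * B)) * 0); last by rewrite mulr0.
  rewrite -[X in _ = _ * X]Em mulr_sumr; apply: eq_bigr => i _; rewrite mulr_sumr.
  by apply: eq_bigr => j _; rewrite mulrCA -expRD; congr (_ * expR _); ring.
(* Let [m] tend to infinity. *)
have: \sum_i \sum_j v i * v j * (i == j)%:R = 0.
  apply: (@cvg_unique _ (@Rhausdorff R)
    ((\sum_i \sum_j v i * v j * expR (- (m%:R * d (x i) (x j)))) @[m --> \oo])).
    apply: cvgr_sum => i; apply: cvgr_sum => j.
    apply: cvgM; first exact: cvg_cst.
    case: eqVneq => [->|ij].
      rewrite dxx; under eq_fun do rewrite mulr0 oppr0 expR0; exact: cvg_cst.
    have d0 := dxy _ _ ij.
    have dy : m%:R * d (x i) (x j) @[m --> \oo] --> +oo.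
      apply/cvgryPge => A; near=> m; rewrite -ler_pdivrMr//.
      by near: m; exact: nbhs_infty_ger.
    exact: (cvg_comp _ _ dy (@cvgr_expR R)).
  rewrite (_ : (fun m : nat => _) = fun=> 0); first exact: cvg_cst.
  by apply/funext => m; exact: Qm.
apply/eqP; rewrite gt_eqF//.
have diag i : \sum_j v i * v j * (i == j)%:R = v i ^+ 2.
  rewrite (bigD1 i)//= eqxx mulr1 big1 ?addr0// => j /negPf ji.
  by rewrite eq_sym ji mulr0.
under eq_bigr do rewrite diag.
rewrite lt_neqAle sumr_ge0 ?andbT; last by move=> i _; exact: sqr_ge0.
apply/eqP => /esym/psumr_eq0P => /(_ (fun i _ => sqr_ge0 _)) /(_ i0 isT)/eqP.
by rewrite sqrf_eq0 (negPf vi0).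
Unshelve. all: by end_near. Qed.

End psd_kernel.

(** * The distance of L1 *)

Section L1space_facts.
Context d (T : measurableType d) (R : realType).
Variable mu : {measure set T -> \bar R}.
Implicit Types (f g : T -> R) (x y : L1space mu).

Let rint f := mu.-integrable setT (EFin \o f).

Lemma rintegrableD f g : rint f -> rint g -> rint (fun t => f t + g t).
Proof. exact: integrableD. Qed.

Lemma rintegrableZ c f : rint f -> rint (fun t => c * f t).
Proof. exact: integrableZl. Qed.

Lemma rintegrableB f g : rint f -> rint g -> rint (fun t => f t - g t).
Proof. exact: integrableB. Qed.

Lemma rintegrable_norm f : rint f -> rint (fun t => `|f t|).
Proof. exact: integrable_norm. Qed.

Lemma rintegrable_sum (J : Type) (s : seq J) (P : pred J) (F : J -> T -> R) :
  (forall j, P j -> rint (F j)) -> rint (fun t => \sum_(j <- s | P j) F j t).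
Proof.
move=> hF; rewrite /rint (_ : _ \o _ =
    fun t => (\sum_(j <- s | P j) (EFin \o F j) t)%E).
  exact: integrable_sum.
by apply/funext => t /=; rewrite sumEFin.
Qed.

Lemma Rintegral_sum (J : Type) (s : seq J) (F : J -> T -> R) :
  (forall j, rint (F j)) ->
  \int[mu]_t (\sum_(j <- s) F j t) = \sum_(j <- s) \int[mu]_t F j t.
Proof.
move=> hF; elim: s => [|j s IHs].
  rewrite big_nil (_ : (fun t => _) = fun=> 0); last first.
    by apply/funext => t; rewrite big_nil.
  by rewrite /Rintegral integral0.
rewrite big_cons -IHs -RintegralD//; [|exact: hF|exact: rintegrable_sum].
by apply: eq_Rintegral => t _; rewrite big_cons.
Qed.

Lemma ae_eq_Rintegral f g : rint f -> rint g -> f = g %[ae mu] ->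
  \int[mu]_t f t = \int[mu]_t g t.
Proof.
move=> /measurable_int mf /measurable_int mg fg.
rewrite /Rintegral; congr fine; apply: ae_eq_integral => //.
by apply: filterS fg => t /= h /h ->.
Qed.

Lemma ae_le_Rintegral f g : rint f -> rint g ->
  (\forall t \ae mu, f t <= g t) -> \int[mu]_t f t <= \int[mu]_t g t.
Proof.
move=> If Ig fg; rewrite -subr_ge0 -RintegralB//.
have IB := rintegrableB Ig If.
rewrite (@ae_eq_Rintegral _ (fun t => `|g t - f t|))//.
- by apply: Rintegral_ge0 => t _; exact: normr_ge0.
- exact: rintegrable_norm.
- by apply: filterS fg => t h _; rewrite ger0_norm// subr_ge0.
Qed.

Lemma L1fun_integrable x : rint (L1fun x).
Proof. exact/Lfun1_integrable/L1rep_subproof. Qed.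

Lemma L1norm_int x : `|x| = \int[mu]_t `|L1fun x t|.
Proof. by []. Qed.

Lemma L1funD x y : L1fun (x + y) = (fun t => L1fun x t + L1fun y t) %[ae mu].
Proof. exact: L1class_ae. Qed.

Lemma L1funZ (a : R) x : L1fun (a *: x) = (fun t => a * L1fun x t) %[ae mu].
Proof. exact: L1class_ae. Qed.

Lemma L1funN x : L1fun (- x) = (fun t => - L1fun x t) %[ae mu].
Proof. exact: L1class_ae. Qed.

Lemma L1fun0 : L1fun (0 : L1space mu) = (fun=> 0) %[ae mu].
Proof. exact: L1class_ae. Qed.

Lemma L1fun_sumZ (J : Type) (s : seq J) (c : J -> R) (X : J -> L1space mu) :
  L1fun (\sum_(j <- s) c j *: X j) =
    (fun t => \sum_(j <- s) c j * L1fun (X j) t) %[ae mu].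
Proof.
elim: s => [|j s IHs].
  by rewrite big_nil; apply: filterS L1fun0 => t h /h ->; rewrite big_nil.
rewrite big_cons; apply: filterS3 IHs (L1funZ (c j) (X j))
  (L1funD (c j *: X j) (\sum_(k <- s) c k *: X k)) => t h1 h2 h3 Dt.
by rewrite h3// h2// h1// big_cons.
Qed.

Lemma L1norm_ae x f : rint f -> L1fun x = f %[ae mu] ->
  `|x| = \int[mu]_t `|f t|.
Proof.
move=> If xf; rewrite L1norm_int; apply: ae_eq_Rintegral.
- exact/rintegrable_norm/L1fun_integrable.
- exact: rintegrable_norm.
- by apply: filterS xf => t h /h ->.
Qed.

Lemma L1dist_int x y : `|x - y| = \int[mu]_t `|L1fun x t - L1fun y t|.
Proof.
apply: L1norm_ae; first by apply: rintegrableB; exact: L1fun_integrable.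
apply: filterS2 (L1funD x (- y)) (L1funN y) => t h1 h2 Dt.
by rewrite h1// h2.
Qed.

(** Pointwise in [t], [psd_kernel_absdist] applies to the values at [t]; the
    kernel below is the integral of these. *)
Lemma psd_multiplier_L1dist (X : Type) (F : X -> L1space mu) (rho : T -> R) :
  rint rho -> (forall x : X, \forall t \ae mu, `|L1fun (F x) t| <= rho t) ->
  psd_multiplier (fun x y : X => 2 * (\int[mu]_t rho t) - `|F x - F y|).
Proof.
move=> Irho Frho H psdH I x v.
have Idist i j : rint (fun t => 2 * rho t -
    `|L1fun (F (x i)) t - L1fun (F (x j)) t|).
  apply: rintegrableB; first exact: rintegrableZ.
  by apply/rintegrable_norm/rintegrableB; exact: L1fun_integrable.
pose c i j := v i * v j * H (x i) (x j).
have -> : \sum_i \sum_j v i * v j *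
      ((2 * (\int[mu]_t rho t) - `|F (x i) - F (x j)|) * H (x i) (x j)) =
    \int[mu]_t (\sum_i \sum_j c i j * (2 * rho t -
      `|L1fun (F (x i)) t - L1fun (F (x j)) t|)).
  rewrite Rintegral_sum; last first.
    by move=> i; apply: rintegrable_sum => j _; exact: rintegrableZ.
  apply: eq_bigr => i _; rewrite Rintegral_sum; last first.
    by move=> j; exact: rintegrableZ.
  apply: eq_bigr => j _; rewrite RintegralZl; [|by []|exact: Idist].
  rewrite RintegralB; [|by []|exact: rintegrableZ|]; last first.
    by apply/rintegrable_norm/rintegrableB; exact: L1fun_integrable.
  by rewrite RintegralZl// L1dist_int /c; ring.
rewrite -[leLHS](_ : \int[mu]_t (0 : R) = 0); last first.
  by rewrite Rintegral_cst// mul0r.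
apply: ae_le_Rintegral.
- exact: integrable0.
- by apply: rintegrable_sum => i _; apply: rintegrable_sum => j _; exact: rintegrableZ.
have aeF : \forall t \ae mu, forall i, `|L1fun (F (x i)) t| <= rho t.
  by apply: filter_forall => i; exact: Frho.
apply: filterS aeF => t Ft.
have := psd_kernel_absdist Ft _ id v; move=> /(_ (fun i j => H (x i) (x j))).
have psdHx : psd_kernel (fun i j => H (x i) (x j)).
  by move=> I' x' v'; exact: (psdH I' (x \o x') v').
move=> /(_ psdHx)/le_trans; apply; apply: ler_sum => i _; apply: ler_sum => j _.
by rewrite /c le_eqVlt; apply/orP; left; apply/eqP; ring.
Qed.

End L1space_facts.

(** * Fejer's kernel on the integer lattice *)

Section trigonometry.
Context (R : realType).
Implicit Types (a b : R).

Lemma cosDint a (z : int) : cos (a + z%:~R * (pi *+ 2)) = cos a.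
Proof.
have nat_case (k : nat) b : cos (b + k%:R * (pi *+ 2)) = cos b.
  by rewrite mulr_natl (periodicn (@cosD2pi R)).
case: z => k; first exact: nat_case.
by rewrite NegzE mulrNz mulNr -[LHS](nat_case k.+1) subrK.
Qed.

Lemma sinDint a (z : int) : sin (a + z%:~R * (pi *+ 2)) = sin a.
Proof.
have nat_case (k : nat) b : sin (b + k%:R * (pi *+ 2)) = sin b.
  by rewrite mulr_natl (periodicn (@sinD2pi R)).
case: z => k; first exact: nat_case.
by rewrite NegzE mulrNz mulNr -[LHS](nat_case k.+1) subrK.
Qed.

Lemma cos_lt1 a : 0 < `|a| < pi *+ 2 -> cos a < 1.
Proof.
rewrite -cos_norm; move: `|a| => {}a /andP[a0 api].
have -> : cos a = 1 - sin (a / 2) ^+ 2 *+ 2.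
  have {1}-> : a = (a / 2) *+ 2 by rewrite -mulr_natr; field.
  by rewrite cos_mulr2n cos2sin2; ring.
have : 0 < sin (a / 2).
  by apply: sin_gt0_pi; move: api; rewrite mulr2n => api; apply/andP; split; lra.
by move=> /(exprn_gt0 2); lra.
Qed.

End trigonometry.

Section lattice_sums.
Context (R : realType) (n : nat).
Implicit Types (z : 'rV[int]_n) (th : 'rV[R]_n).

Definition dotz z th : R := \sum_i (z 0 i)%:~R * th 0 i.

Lemma dotzD z1 z2 th : dotz (z1 + z2) th = dotz z1 th + dotz z2 th.
Proof.
by rewrite -big_split /=; apply: eq_bigr => i _; rewrite mxE intrD mulrDl.
Qed.

Lemma dotzN z th : dotz (- z) th = - dotz z th.
Proof. by rewrite -sumrN; apply: eq_bigr => i _; rewrite mxE mulrNz mulNr. Qed.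

Lemma dotz0 th : dotz 0 th = 0.
Proof. by rewrite /dotz big1// => i _; rewrite mxE mul0r. Qed.

Lemma dotz_scale (k : int) z th : dotz (k *: z) th = k%:~R * dotz z th.
Proof.
by rewrite mulr_sumr; apply: eq_bigr => i _; rewrite mxE intrM mulrA.
Qed.

Variable M : nat.

Let q := (2 * M)%N.+1.

(** An odd number of points per axis, centred so that all frequencies lie in
    $[-\pi,\pi]^n$, the range where [1 - cos] bounds them from below. *)
Definition grid (j : {ffun 'I_n -> 'I_q}) : 'rV[R]_n :=
  \row_i (pi *+ 2 / q%:R * ((j i)%:R - M%:R)).

Lemma grid_le_pi j i : `|grid j 0 i| <= pi.
Proof.
have q0 : 0 < q%:R :> R by rewrite ltr0n.
have jM : `|(j i)%:R - M%:R| <= q%:R / 2 :> R.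
  have := ltn_ord (j i); rewrite /q ltnS -(ler_nat R) natrM => jM.
  rewrite -natr1 natrM ler_norml; apply/andP; split; last by lra.
  by have : 0 <= (j i)%:R :> R by []; lra.
have c0 : 0 <= pi *+ 2 / q%:R :> R by rewrite divr_ge0// mulrn_wge0// pi_ge0.
rewrite mxE normrM (ger0_norm c0) (le_trans (ler_wpM2l c0 jM))//.
rewrite le_eqVlt; apply/orP; left; apply/eqP. field.
by rewrite gt_eqF.
Qed.

(** Shifting one coordinate of the grid rotates the pair of sums (of cosines
    and of sines) by a nontrivial angle, so both vanish. *)
Lemma sum_cos_grid0 z i0 : z 0 i0 != 0 -> `|z 0 i0| < q%:Z ->
  \sum_j cos (dotz z (grid j)) = 0.
Proof.
move=> zi0 ziq.
pose b : R := (z 0 i0)%:~R * (pi *+ 2 / q%:R).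
have q0 : 0 < q%:R :> R by rewrite ltr0n.
pose sh (j : {ffun 'I_n -> 'I_q}) : {ffun 'I_n -> 'I_q} :=
  [ffun i => if i == i0 then ordS (j i) else j i].
pose sh' (j : {ffun 'I_n -> 'I_q}) : {ffun 'I_n -> 'I_q} :=
  [ffun i => if i == i0 then ord_pred (j i) else j i].
have shK : cancel sh sh'.
  by move=> j; apply/ffunP => i; rewrite !ffunE; case: eqP => // _; rewrite ordSK.
have sh'K : cancel sh' sh.
  by move=> j; apply/ffunP => i; rewrite !ffunE; case: eqP => // _; rewrite ord_predK.
have dot_sh j : exists k : int,
    dotz z (grid (sh j)) = dotz z (grid j) + b + k%:~R * (pi *+ 2).
  have [k hk] : exists k : int, (ordS (j i0) : nat)%:R =
      (j i0)%:R + 1 + k%:~R * q%:R :> R.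
    have [jq|jq] := ltnP (j i0).+1 q.
      by exists 0; rewrite mul0r addr0 /= modn_small// -natr1.
    have jE : (j i0).+1 = q by apply/eqP; rewrite eqn_leq jq ltn_ord.
    by exists (-1); rewrite natr1 [nat_of_ord _]/= jE modnn mulrNz mulN1r subrr.
  exists (z 0 i0 * k).
  rewrite /dotz (bigD1 i0)//= [in RHS](bigD1 i0)//= !mxE ffunE eqxx hk.
  rewrite (eq_bigr (fun i => (z 0 i)%:~R * grid j 0 i)); last first.
    by move=> i /negPf ii0; rewrite !mxE ffunE ii0.
  rewrite /b intrM; set S := \sum_(i | _) _; field.
  by rewrite gt_eqF.
set C := \sum_j _; pose S := \sum_j sin (dotz z (grid j)).
have CE : C = cos b * C - sin b * S.
  rewrite {1}/C (reindex sh) /=; last by exists sh' => ? _; [exact: shK|exact: sh'K].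
  rewrite mulr_sumr mulr_sumr -sumrB; apply: eq_bigr => j _.
  by have [k ->] := dot_sh j; rewrite cosDint cosD mulrC [sin b * _]mulrC.
have SE : S = cos b * S + sin b * C.
  rewrite {1}/S (reindex sh) /=; last by exists sh' => ? _; [exact: shK|exact: sh'K].
  rewrite mulr_sumr mulr_sumr -big_split; apply: eq_bigr => j _.
  by have [k ->] := dot_sh j; rewrite sinDint sinD /= mulrC [sin b * _]mulrC.
have cb : cos b < 1.
  have p2 : 0 < (pi : R) *+ 2 by rewrite pmulrn_lgt0// pi_gt0.
  apply: cos_lt1; apply/andP; split.
    by rewrite normr_gt0 mulf_neq0 ?intr_eq0// mulf_neq0 ?invr_eq0 ?gt_eqF.
  rewrite /b normrM [X in _ * X]gtr0_norm ?divr_gt0//.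
  rewrite mulrA ltr_pdivrMr// mulrC ltr_pM2l//.
  by rewrite -intr_norm -[q%:R]/(q%:Z%:~R) ltr_int.
have : C * ((1 - cos b) ^+ 2 + sin b ^+ 2) = 0.
  have e1 : (1 - cos b) * C = - sin b * S by rewrite mulrBl mul1r {1}CE; ring.
  have e2 : (1 - cos b) * S = sin b * C by rewrite mulrBl mul1r {1}SE; ring.
  transitivity ((1 - cos b) * ((1 - cos b) * C) + sin b * (sin b * C)); first ring.
  by rewrite e1 -e2; ring.
move=> /eqP; rewrite mulf_eq0 => /orP[/eqP//|].
by rewrite gt_eqF// ltr_pwDl ?sqr_ge0// exprn_gt0// subr_gt0.
Qed.

Lemma sum_cos_grid z : (forall i, `|z 0 i| < q%:Z) ->
  \sum_j cos (dotz z (grid j)) = (q ^ n)%:R * (z == 0)%:R.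
Proof.
move=> zq; have [->|z0] := eqVneq z 0.
  under eq_bigr do rewrite dotz0 cos0.
  by rewrite sumr_const card_ffun !card_ord mulr1.
rewrite mulr0; have [i0 zi0] : exists i0, z 0 i0 != 0.
  apply/existsP; apply: contraNT z0; rewrite negb_exists => /forallP h.
  by apply/eqP/rowP => i; rewrite mxE; apply/eqP/negPn/h.
exact: sum_cos_grid0 zi0 (zq i0).
Qed.

Definition box (m : {ffun 'I_n -> 'I_M}) : 'rV[int]_n := \row_i (m i)%:Z.

Lemma box_inj : injective box.
Proof.
move=> m m' /rowP mm; apply/ffunP => i; apply/val_inj.
by have := mm i; rewrite !mxE => -[].
Qed.

Definition box_diff z := #|[pred mm | box mm.1 - box mm.2 == z]|.

Lemma box_diff_le z : (box_diff z <= M ^ n)%N.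
Proof.
rewrite -[M in X in (_ <= X)%N]card_ord -[n in X in (_ <= X)%N]card_ord -card_ffun.
rewrite /box_diff -(@card_in_image _ _ fst) ?max_card// => -[m1 m2] [m1' m2'].
rewrite !inE /= => /eqP mz /eqP mz' m11; congr (_, _) => //.
by apply: box_inj; apply: oppr_inj; apply: (@addrI _ (box m1)); rewrite mz m11 mz'.
Qed.

(** The cube of side [M - K] embeds in the set of pairs with difference [z] by
    adding the positive and the negative part of [z]. *)
Lemma box_diff_ge (K : nat) z : (K <= M)%N -> (forall i, `|z 0 i| <= K%:Z) ->
  ((M - K) ^ n <= box_diff z)%N.
Proof.
move=> KM zK.
pose pos (x : int) : nat := if x is Posz k then k else 0%N.
have posE x : (pos x)%:Z - (pos (- x))%:Z = x by case: x => [[]|] //= k; lia.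
have pos_lt (i : 'I_n) (a : 'I_(M - K)) (x : int) : `|x| <= K%:Z -> (pos x + a < M)%N.
  by have := ltn_ord a; case: x => k /=; lia.
have zNK i : `|- z 0 i| <= K%:Z by rewrite normrN.
pose up (a : {ffun 'I_n -> 'I_(M - K)}) : {ffun 'I_n -> 'I_M} :=
  [ffun i => Ordinal (pos_lt i (a i) _ (zK i))].
pose dn (a : {ffun 'I_n -> 'I_(M - K)}) : {ffun 'I_n -> 'I_M} :=
  [ffun i => Ordinal (pos_lt i (a i) _ (zNK i))].
rewrite -[(M - K)%N]card_ord -[n in X in (X <= _)%N]card_ord -card_ffun.
rewrite -(@card_imset _ _ (fun a => (up a, dn a))); last first.
  move=> a a' [/ffunP uu _]; apply/ffunP => i; apply/val_inj.
  by have /(congr1 val) := uu i; rewrite !ffunE /= => /addnI.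
apply/subset_leq_card/fintype.subsetP => _ /imsetP[a _ ->].
rewrite inE /=; apply/eqP/rowP => i; rewrite !mxE !ffunE /= -[RHS]posE; lia.
Qed.

(** Fejer's argument: averaging a positive definite function on the lattice
    against the characters over a box exhibits it, up to the factor counting
    pairs in the box, as a positive combination of characters. *)
Lemma fejer_weights (phi : 'rV[int]_n -> R) : (0 < M)%N ->
  psd_kernel (fun y z => phi (y - z)) -> (forall z, phi (- z) = phi z) ->
  exists2 p : {ffun 'I_n -> 'I_q} -> R, (forall j, 0 <= p j) &
    forall z, (forall i, `|z 0 i| <= M%:Z) ->
      \sum_j p j * cos (dotz z (grid j)) =
        phi z * ((box_diff z)%:R / (M ^ n)%:R).
Proof.
move=> M0 psd_phi phiN.
pose P (j : {ffun 'I_n -> 'I_q}) := \sum_m \sum_m' phi (box m - box m') *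
  cos (dotz (box m - box m') (grid j)).
have qn0 : ((q ^ n)%:R : R) != 0 by rewrite pnatr_eq0 expn_eq0.
have Mn0 : ((M ^ n)%:R : R) != 0 by rewrite pnatr_eq0 expn_eq0 (gtn_eqF M0).
(* Writing [cos (a - b)] as a sum of two rank-one kernels. *)
have P_ge0 j : 0 <= P j.
  have := addr_ge0 (psd_phi _ box (fun m => cos (dotz (box m) (grid j))))
    (psd_phi _ box (fun m => sin (dotz (box m) (grid j)))).
  rewrite -big_split /=; congr (_ <= _); apply: eq_bigr => m _.
  rewrite -big_split /=; apply: eq_bigr => m' _.
  by rewrite dotzD dotzN cosB; ring.
exists (fun j => P j / ((q ^ n)%:R * (M ^ n)%:R)) => [j|z zM].
  by rewrite divr_ge0.
have diff_lt m m' z' : (forall i, `|z' 0 i| <= M%:Z) ->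
    forall i, `|(box m - box m' + z') 0 i| < q%:Z.
  move=> z'M i; have := z'M i; have := ltn_ord (m i); have := ltn_ord (m' i).
  rewrite !mxE /q ler_norml ltr_norml.
  by move: (z' 0 i) (m i : nat) (m' i : nat) => a b c; lia.
(* Orthogonality of the characters picks out the pairs differing by [z']. *)
have sum2 z' : (forall i, `|z' 0 i| <= M%:Z) ->
    \sum_m \sum_m' phi (box m - box m') *
      \sum_j cos (dotz (box m - box m' + z') (grid j)) =
    (q ^ n)%:R * (phi z' * (box_diff z')%:R).
  move=> z'M.
  have -> : (box_diff z')%:R = \sum_m \sum_m' (box m' - box m == z')%:R :> R.
    rewrite exchange_big /= pair_big /= /box_diff -sum1_card natr_sum big_mkcond /=.
    by apply: eq_bigr => -[m m'] _; rewrite inE /=; case: eqP.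
  rewrite !mulr_sumr; apply: eq_bigr => m _; rewrite !mulr_sumr.
  apply: eq_bigr => m' _; rewrite sum_cos_grid; last exact: diff_lt.
  have -> : (box m - box m' + z' == 0) = (box m' - box m == z').
    by rewrite -opprB addrC subr_eq0 eq_sym.
  case: eqP => [<-|]; last by rewrite !mulr0.
  by rewrite -opprB phiN; ring.
have zNM i : `|(- z) 0 i| <= M%:Z by rewrite mxE normrN.
have box_diffN : box_diff (- z) = box_diff z.
  pose sw (mm : {ffun 'I_n -> 'I_M} * {ffun 'I_n -> 'I_M}) := (mm.2, mm.1).
  have swK : involutive sw by case.
  rewrite /box_diff -(fintype.card_image (inv_inj swK)).
  apply: eq_card => mm; rewrite -{1}(swK mm) (fintype.mem_image (inv_inj swK)) !inE /=.
  by rewrite -opprB (inj_eq oppr_inj).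
transitivity (((q ^ n)%:R * (M ^ n)%:R)^-1 * (2^-1 *
   (\sum_m \sum_m' phi (box m - box m') *
      \sum_j cos (dotz (box m - box m' + z) (grid j)) +
    \sum_m \sum_m' phi (box m - box m') *
      \sum_j cos (dotz (box m - box m' + - z) (grid j))))); last first.
  rewrite sum2// sum2// phiN box_diffN; field.
  by rewrite Mn0 qn0.
transitivity (((q ^ n)%:R * (M ^ n)%:R)^-1 *
    \sum_j P j * cos (dotz z (grid j))).
  by rewrite mulr_sumr; apply: eq_bigr => j _; ring.
congr (_ * _).
under eq_bigr do rewrite mulr_suml; rewrite exchange_big /= -big_split /= mulr_sumr.
apply: eq_bigr => m _; under eq_bigr do rewrite mulr_suml.
rewrite exchange_big /= -big_split /= mulr_sumr; apply: eq_bigr => m' _.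
rewrite -mulrDr -big_split /= !mulr_sumr; apply: eq_bigr => j _.
rewrite (dotzD _ z) (dotzD _ (- z)) dotzN.
by rewrite cosB cosD; field.
Qed.

End lattice_sums.

(** * Seminorms of negative type as combinations of 1 - cos *)

Lemma expRN_le_quad (R : realType) (u : R) : 0 <= u ->
  expR (- u) <= 1 - u + u ^+ 2.
Proof.
move=> u0; rewrite expRN.
have u1 : 0 < 1 + u by rewrite ltr_wpDr.
apply: (@le_trans _ _ (1 + u)^-1).
  by rewrite lef_pV2 ?posrE ?expR_gt0// expR_ge1Dx.
rewrite -div1r ler_pdivrMr//.
have -> : (1 - u + u ^+ 2) * (1 + u) = 1 + u ^+ 3 by ring.
by rewrite lerDl exprn_ge0.
Qed.

Lemma bernoulli_ineq (R : realFieldType) (u : R) n : 0 <= u <= 1 ->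
  1 - n%:R * u <= (1 - u) ^+ n.
Proof.
move=> /andP[u0 u1]; elim: n => [|n IHn]; first by rewrite mul0r subr0.
have u1' : 0 <= 1 - u by rewrite subr_ge0.
rewrite exprS; apply: le_trans (ler_wpM2l u1' IHn).
rewrite -subr_ge0 -natr1.
have -> : (1 - u) * (1 - n%:R * u) - (1 - (n%:R + 1) * u) = n%:R * u ^+ 2 by ring.
by rewrite mulr_ge0// sqr_ge0.
Qed.

Section seminorm_approximation.
Context (R : realType) (n : nat).

Definition z2r (z : 'rV[int]_n) : 'rV[R]_n := map_mx intr z.

Lemma z2rD z z' : z2r (z + z') = z2r z + z2r z'.
Proof. exact: map_mxD. Qed.

Lemma z2rN z : z2r (- z) = - z2r z.
Proof. exact: map_mxN. Qed.

Lemma z2rZ (k : int) z : z2r (k *: z) = k%:~R *: z2r z.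
Proof. exact: map_mxZ. Qed.

Variable N : 'rV[R]_n -> R.
Hypothesis NZ : forall a x, N (a *: x) = `|a| * N x.
Hypothesis ND : forall x y, N (x + y) <= N x + N y.
Hypothesis psdN : psd_kernel (fun x y => expR (- N (x - y))).

Lemma seminorm0 : N 0 = 0.
Proof. by rewrite -(scale0r 0) NZ normr0 mul0r. Qed.

Lemma seminormN x : N (- x) = N x.
Proof. by rewrite -scaleN1r NZ normrN1 mul1r. Qed.

Lemma seminorm_ge0 x : 0 <= N x.
Proof. by have := ND x (- x); rewrite subrr seminorm0 seminormN; lra. Qed.

Let C := \sum_i N (delta_mx 0 i).

Lemma seminorm_le_coord (x : 'rV[R]_n) (k : R) : (forall i, `|x 0 i| <= k) ->
  N x <= k * \sum_i N (delta_mx 0 i).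
Proof.
move=> xk; rewrite {1}(matrix_sum_delta x) big_ord1.
apply: (@le_trans _ _ (\sum_i N (x 0 i *: delta_mx 0 i))).
  elim/big_ind2: _ => //; first by rewrite seminorm0.
  by move=> a b c e ab ce; rewrite (le_trans (ND _ _))// lerD.
rewrite mulr_sumr; apply: ler_sum => i _.
by rewrite NZ ler_wpM2r// seminorm_ge0.
Qed.

(** With [phi = exp (- t N)] and a box large compared with [1 / t], the Fejer
    weights divided by [t] represent [(1 - phi) / t], which is [N] up to
    [O(t N^2)]. *)
Lemma seminorm_approx (K : nat) (delta : R) : 0 < delta ->
  exists (J : finType) (p : J -> R) (th : J -> 'rV[R]_n),
    [/\ forall j, 0 <= p j, forall j i, `|th j 0 i| <= pi &
      forall z : 'rV[int]_n, (forall i, `|z 0 i| <= K%:Z) ->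
        `|N (z2r z) - \sum_j p j * (1 - cos (dotz z (th j)))| <= delta].
Proof.
move=> d0; pose B := K%:R * C + 1.
have C0 : 0 <= C by apply: sumr_ge0 => i _; exact: seminorm_ge0.
have B0 : 0 < B by rewrite ltr_wpDl// mulr_ge0.
(* [B] bounds [N] on the cube of side [K]; [t] makes the quadratic error
   [t B ^ 2] at most [delta / 2], and [M] is large enough for the loss [n K / M]
   of the Fejer weights to be at most [t delta / 2]. *)
pose t := delta / (2 * B ^+ 2).
have t0 : 0 < t by rewrite divr_gt0// mulr_gt0// exprn_gt0.
pose a := n%:R * K%:R * 2 / (t * delta).
have td : 0 < t * delta by rewrite mulr_gt0.
have a0 : 0 <= a by apply: divr_ge0; [rewrite !mulr_ge0|exact: ltW].
pose M := (Num.bound a + K).+1.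
have aM : a <= M%:R.
  have := archi_boundP a0; rewrite /M -natr1 natrD.
  by have : 0 <= K%:R :> R by []; lra.
have M0 : (0 < M)%N by [].
have M0' : 0 < M%:R :> R by rewrite ltr0n.
have KM : (K <= M)%N by rewrite /M; lia.
pose phi z := expR (- (t * N (z2r z))).
have psd_phi : psd_kernel (fun y z => phi (y - z)).
  move=> I x v; have := psdN (fun i => t *: z2r (x i)) v.
  congr (_ <= _); apply: eq_bigr => i _; apply: eq_bigr => j _.
  by rewrite -scalerBr NZ gtr0_norm// /phi z2rD z2rN.
have phiN z : phi (- z) = phi z by rewrite /phi z2rN seminormN.
have [p p0 pE] := fejer_weights M0 psd_phi phiN.
pose r (z : 'rV[int]_n) : R := (box_diff M z)%:R / (M ^ n)%:R.
have Mn0 : 0 < (M ^ n)%:R :> R by rewrite ltr0n expn_gt0.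
have r0 : r 0 = 1.
  rewrite /r [box_diff _ _](_ : _ = (M ^ n)%N) ?divff ?gt_eqF//.
  apply/eqP; rewrite eqn_leq box_diff_le/=.
  by rewrite -{1}(subn0 M) box_diff_ge// => i; rewrite mxE normr0.
have r_le1 z : r z <= 1.
  by rewrite /r ler_pdivrMr// mul1r ler_nat box_diff_le.
have r_ge (z : 'rV[int]_n) : (forall i, `|z 0 i| <= K%:Z) ->
    1 - r z <= t * delta / 2.
  move=> zK.
  have KMR : 0 <= (K%:R / M%:R : R) <= 1.
    by apply/andP; split; [rewrite divr_ge0|rewrite ler_pdivrMr// mul1r ler_nat].
  have h1 : (1 - K%:R / M%:R) ^+ n <= r z.
    rewrite /r ler_pdivlMr// natrX -exprMn mulrBl mul1r divfK ?gt_eqF//.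
    by rewrite -natrB// -natrX ler_nat box_diff_ge.
  have := bernoulli_ineq n KMR.
  have : n%:R * (K%:R / M%:R) <= t * delta / 2.
    rewrite mulrA ler_pdivrMr//.

    move: aM; rewrite /a ler_pdivrMr//; lra.
  lra.
exists [the finType of {ffun 'I_n -> 'I_((2 * M)%N.+1)}], (fun j => p j / t),
  (@grid R n M).
split=> [j|j i|z zK]; [by rewrite divr_ge0// ltW|exact: grid_le_pi|].
have zM i : `|z 0 i| <= M%:Z by rewrite (le_trans (zK i))// lez_nat.
have p0E := pE 0 _; have pzE := pE z zM.
have -> : \sum_j p j / t * (1 - cos (dotz z (grid R j))) =
    (1 - phi z * r z) / t.
  transitivity ((\sum_j p j * cos (dotz 0 (grid R j)) -
      \sum_j p j * cos (dotz z (grid R j))) / t).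
    rewrite -sumrB mulr_suml; apply: eq_bigr => j _.
    by rewrite dotz0 cos0; ring.
  rewrite pzE p0E; last by move=> i; rewrite mxE normr0.
  by rewrite -/(r 0) r0 /phi /z2r map_mx0 seminorm0 mulr0 oppr0 expR0 mulr1.
set u := t * N (z2r z).
have Nz0 : 0 <= N (z2r z) := seminorm_ge0 _.
have NB : N (z2r z) <= B.
  apply: le_trans (seminorm_le_coord (k := K%:R) _) _; last by rewrite /B lerDl.
  by move=> i; rewrite mxE -intr_norm -[K%:R]/(K%:Z%:~R) ler_int.
have u0 : 0 <= u by rewrite mulr_ge0// ltW.
have u2 : u ^+ 2 <= t * delta / 2.
  have -> : t * delta / 2 = t * (t * B ^+ 2).
    by rewrite /t; field; rewrite gt_eqF.
  rewrite /u exprMn expr2 -mulrA !ler_pM2l//.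
  by rewrite ler_sqr ?nnegrE// ltW.
have e1 : phi z <= 1 - u + u ^+ 2 := expRN_le_quad u0.
have e2 : 1 - u <= phi z by have := expR_ge1Dx (- u).
have e3 : 0 <= phi z <= 1 by rewrite expR_ge0 expR_le1 oppr_le0.
have rz := r_ge z zK; have rz1 := r_le1 z.
have key : `|u - (1 - phi z * r z)| <= t * delta.
  have : 0 <= phi z * (1 - r z) <= 1 - r z.
    case/andP: e3 => e30 e31; rewrite mulr_ge0 ?subr_ge0//=.
    by rewrite ler_piMl// subr_ge0.
  by rewrite mulrBr mulr1 ler_norml => /andP[h1 h2]; apply/andP; split; lra.
have -> : N (z2r z) - (1 - phi z * r z) / t = (u - (1 - phi z * r z)) / t.
  by rewrite /u; field; rewrite gt_eqF.
by rewrite normrM normfV (gtr0_norm t0) ler_pdivrMr// [delta * t]mulrC.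
Qed.

End seminorm_approximation.

(** * The triangle wave *)

Section mean_value.
Context (R : realType).
Implicit Types (f df : R -> R) (a b k : R).

Lemma mvt_exists f df a b : a <= b ->
  (forall x, a <= x <= b -> is_derive x 1 f (df x)) ->
  exists2 c, a <= c <= b & f b - f a = df c * (b - a).
Proof.
move=> ab fd.
have [||c] := @MVT_segment R f df a b ab.
- by move=> x; rewrite in_itv /= => /andP[ax xb]; apply: fd; rewrite !ltW.
- apply: derivable_within_continuous => x; rewrite in_itv /= => /fd fx.
  exact: ex_derive.
by rewrite in_itv /= => ? ?; exists c.
Qed.

Lemma mvt_le f df a b k : a <= b ->
  (forall x, a <= x <= b -> is_derive x 1 f (df x)) ->
  (forall x, a <= x <= b -> `|df x| <= k) ->
  `|f b - f a| <= k * (b - a).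
Proof.
move=> ab fd dk; have [c cab ->] := mvt_exists ab fd.
rewrite normrM (@ger0_norm _ (b - a)) ?subr_ge0// ler_wpM2r ?subr_ge0//.
exact: dk.
Qed.

Lemma norm_sin_le (s : R) : `|sin s| <= `|s|.
Proof.
wlog s0 : s / 0 <= s.
  move=> h; have [s0|/ltW s0] := leP 0 s; first exact: h.
  by have := h (- s); rewrite sinN !normrN oppr_ge0; apply.
have := @mvt_le sin cos 0 s 1 s0; rewrite sin0 !subr0 mul1r => h.
rewrite (ger0_norm s0); by apply: h => x _; exact: cos_max.
Qed.

Lemma cos_half (s : R) : 1 - cos s = 2 * sin (s / 2) ^+ 2.
Proof.
have {1}-> : s = (s / 2) *+ 2 by rewrite -mulr_natr; field.
by rewrite cos_mulr2n cos2sin2; ring.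
Qed.

Lemma cos_le_quad (s : R) : 1 - cos s <= s ^+ 2 / 2.
Proof.
rewrite cos_half; have := norm_sin_le (s / 2).
rewrite -ler_sqr ?nnegrE// !real_normK ?num_real//; lra.
Qed.

Lemma cos_ge_quad (s : R) : `|s| <= 1 -> s ^+ 2 / 8 <= 1 - cos s.
Proof.
move=> s1; rewrite cos_half.
wlog s0 : s s1 / 0 <= s.
  move=> h; have [s0|/ltW s0] := leP 0 s; first exact: h.
  by have := h (- s); rewrite normrN mulNr sinN !sqrrN oppr_ge0; apply.
have s2 : s <= 1 by move: s1; rewrite ger0_norm.
have [|c /andP[c0 cs]] := @mvt_exists sin cos 0 (s / 2) _ (fun x _ => is_derive_sin x).
  by rewrite divr_ge0.
rewrite sin0 !subr0 => ->.
have cos_c : 1 / 2 <= cos c.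
  have := cos_le_quad c.
  have : c ^+ 2 <= 1 by rewrite expr_le1//; lra.
  lra.
rewrite exprMn.
have : 1 / 4 <= cos c ^+ 2.
  have -> : 1 / 4 = (1 / 2) ^+ 2 :> R by field.
  by rewrite ler_sqr ?nnegrE//; lra.
have : 0 <= (s / 2) ^+ 2 by exact: sqr_ge0.
have -> : (s / 2) ^+ 2 = s ^+ 2 / 4 by field.
nra.
Qed.

End mean_value.

Section triangle_wave.
Context (R : realType).
Implicit Types (s a b : R) (L : nat).

(** The partial sums of the Fourier series of the triangle wave. *)
Definition odd_cos_sum L s : R :=
  \sum_(l < L) (1 - cos ((2 * l%:R + 1) * s)) / (2 * l%:R + 1) ^+ 2.

Let odd_sin_sum L s : R := \sum_(l < L) sin ((2 * l%:R + 1) * s) / (2 * l%:R + 1).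

Let odd_gt0 l : 0 < 2 * l%:R + 1 :> R.
Proof. by rewrite ltr_wpDl// mulr_ge0. Qed.

Let term_ge0 l s : 0 <= (1 - cos ((2 * l%:R + 1) * s)) / (2 * l%:R + 1) ^+ 2.
Proof.
apply: divr_ge0; first by rewrite subr_ge0 cos_le1.
exact/exprn_ge0/ltW.
Qed.

Lemma odd_cos_sum_ge0 L s : 0 <= odd_cos_sum L s.
Proof. by apply: sumr_ge0 => l _; exact: term_ge0. Qed.

Lemma odd_cos_sumN L s : odd_cos_sum L (- s) = odd_cos_sum L s.
Proof. by apply: eq_bigr => l _; rewrite mulrN cosN. Qed.

Lemma odd_cos_sum_norm L s : odd_cos_sum L `|s| = odd_cos_sum L s.
Proof. by case: (ger0P s) => // _; exact: odd_cos_sumN. Qed.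

Lemma odd_cos_sum_nondecreasing s : nondecreasing_seq (odd_cos_sum ^~ s).
Proof.
apply/nondecreasing_seqP => L; rewrite /odd_cos_sum big_ord_recr /= lerDl.
exact: term_ge0.
Qed.

Lemma odd_cos_sumS L s : odd_cos_sum L.+1 s =
  odd_cos_sum L s + (1 - cos ((2 * L%:R + 1) * s)) / (2 * L%:R + 1) ^+ 2.
Proof. by rewrite /odd_cos_sum big_ord_recr. Qed.

(** The tail telescopes: [2 / (2 l + 1) ^ 2 <= 1 / l - 1 / (l + 1)]. *)
Lemma odd_cos_sum_tail L L' s : (0 < L)%N -> (L <= L')%N ->
  odd_cos_sum L' s <= odd_cos_sum L s + L%:R^-1 - L'%:R^-1.
Proof.
move=> L0; elim: L' => [|L' IH].
  by rewrite leqn0 => /eqP L00; rewrite L00 in L0.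
rewrite leq_eqVlt => /predU1P[<-|]; first by rewrite addrK.
rewrite ltnS => LL'; rewrite odd_cos_sumS.
have {}IH := IH LL'; have L'0 : 0 < L'%:R :> R by rewrite ltr0n (leq_trans L0).
have L'1 : 0 < L'%:R + 1 :> R by rewrite ltr_wpDl// ltW.
suff h : (1 - cos ((2 * L'%:R + 1) * s)) / (2 * L'%:R + 1) ^+ 2 <=
    L'%:R^-1 - L'.+1%:R^-1.
  by apply: le_trans (lerD IH h) _; rewrite addrA subrK.
have -> : L'%:R^-1 - L'.+1%:R^-1 = (L'%:R * (L'%:R + 1))^-1 :> R.
  by rewrite -[L'.+1%:R]natr1; field; rewrite !gt_eqF.
rewrite ler_pdivrMr ?exprn_gt0// ler_pdivlMl ?mulr_gt0//.
have := cos_geN1 ((2 * L'%:R + 1) * s); nra.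
Qed.

Lemma odd_cos_sum_le3 L s : odd_cos_sum L s <= 3.
Proof.
have [|L0] := leqP L 0.
  by rewrite leqn0 => /eqP ->; rewrite /odd_cos_sum big_ord0.
have := odd_cos_sum_tail s (ltn0Sn 0) L0.
have : odd_cos_sum 1 s <= 2.
  rewrite /odd_cos_sum big_ord1 /= mulr0 add0r expr1n divr1.
  by have := cos_geN1 (1 * s); lra.
have : 0 <= L%:R^-1 :> R by rewrite invr_ge0.
by rewrite invr1; lra.
Qed.

Lemma odd_cos_sum_le_quad L s : odd_cos_sum L s <= L%:R * (s ^+ 2 / 2).
Proof.
rewrite mulr_natl -[L in X in _ <= X]card_ord -sumr_const; apply: ler_sum => l _.
rewrite ler_pdivrMr ?exprn_gt0//.
by have := cos_le_quad ((2 * l%:R + 1) * s); rewrite exprMn; lra.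
Qed.

Let is_derive_odd_cos_sum L s :
  is_derive s 1 (odd_cos_sum L) (odd_sin_sum L s).
Proof.
have -> : odd_cos_sum L = \sum_(l < L) (fun s =>
    (1 - cos ((2 * l%:R + 1) * s)) / (2 * l%:R + 1) ^+ 2).
  by apply/funext => x; rewrite fct_sumE.
apply: is_derive_eq.
apply: eq_bigr => l _; rewrite /GRing.scale /=; field.
by rewrite gt_eqF.
Qed.

Let is_derive_odd_sin_sum L s :
  is_derive s 1 (odd_sin_sum L) (\sum_(l < L) cos ((2 * l%:R + 1) * s)).
Proof.
have -> : odd_sin_sum L = \sum_(l < L) (fun s =>
    sin ((2 * l%:R + 1) * s) / (2 * l%:R + 1)).
  by apply/funext => x; rewrite fct_sumE.
apply: is_derive_eq.
apply: eq_bigr => l _; rewrite /GRing.scale /=; field.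
by rewrite gt_eqF.
Qed.

Let dirichlet L s : 2 * sin s * \sum_(l < L) cos ((2 * l%:R + 1) * s) =
  sin (2 * L%:R * s).
Proof.
elim: L => [|L IH]; first by rewrite big_ord0 !mulr0 mul0r sin0.
rewrite big_ord_recr /= mulrDr IH -[L.+1%:R]natr1.
set a := (2 * L%:R + 1) * s.
have -> : 2 * L%:R * s = a - s by rewrite /a; ring.
have -> : 2 * (L%:R + 1) * s = a + s by rewrite /a; ring.
by rewrite sinB sinD; ring.
Qed.

(** Correcting the sine sum by [cos (2Ls) / (4L sin s)] leaves a function with
    derivative [O(1/L)] away from [0]. *)
Let odd_sin_sum_near eta : 0 < eta <= pi / 2 -> exists2 K, 0 <= K &
  forall L s, (0 < L)%N -> eta <= s <= pi / 2 ->
    `|odd_sin_sum L (pi / 2) - odd_sin_sum L s| <= K / L%:R.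
Proof.
move=> /andP[eta0 etap]; have p0 : 0 < pi / 2 :> R by rewrite divr_gt0// pi_gt0.
set m := sin eta.
have m0 : 0 < m by apply: sin_gt0_pi; rewrite eta0/=; lra.
have sin_m x : eta <= x <= pi / 2 -> m <= sin x.
  move=> /andP[ex xp]; rewrite leNgt ltr_sin ?in_itv/= -?leNgt//;
    apply/andP; split; lra.
exists (pi / 2 / (4 * m ^+ 2) + (4 * m)^-1 + (4 * m)^-1).
  by rewrite ltW// !addr_gt0 ?divr_gt0 ?invr_gt0 ?mulr_gt0 ?exprn_gt0 ?pi_gt0.
move=> L s L0 /andP[es sp].
have LR0 : 0 < L%:R :> R by rewrite ltr0n.
pose w (x : R) : R := cos (2 * L%:R * x) * (4 * L%:R * sin x)^-1.
pose dw (x : R) : R := - (cos (2 * L%:R * x) * cos x) / (4 * L%:R * sin x ^+ 2).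
have dU x : eta <= x <= pi / 2 -> is_derive x 1 (odd_sin_sum L + w) (dw x).
  move=> /sin_m mx; have sx0 : 0 < sin x by exact: lt_le_trans mx.
  have S0 : 4 * L%:R * sin x != 0 by rewrite gt_eqF// !mulr_gt0.
  have dS : is_derive x 1 (fun x => 4 * L%:R * sin x) (4 * L%:R * cos x).
    by apply: is_derive_eq; rewrite /GRing.scale /=; ring.
  have dV := @is_deriveV _ (fun x => 4 * L%:R * sin x) x _ 1 S0 dS.
  have dC : is_derive x 1 (fun x => cos (2 * L%:R * x))
      (- (2 * L%:R * sin (2 * L%:R * x))).
    by apply: is_derive_eq; rewrite /GRing.scale /=; ring.
  have dW : is_derive x 1 w _ := is_deriveM dC dV.
  apply: (is_derive_eq (is_deriveD (is_derive_odd_sin_sum L x) dW)).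
  rewrite /dw /GRing.scale /=.
  have -> : \sum_(l < L) cos ((2 * l%:R + 1) * x) =
      sin (2 * L%:R * x) / (2 * sin x).
    by rewrite -dirichlet; field; rewrite gt_eqF.
  by field; rewrite !gt_eqF.
have dw_le x : eta <= x <= pi / 2 -> `|dw x| <= (4 * L%:R * m ^+ 2)^-1.
  move=> /sin_m mx; have sx0 : 0 < sin x by exact: lt_le_trans mx.
  rewrite /dw mulNr normrN normrM normrM normfV.
  rewrite -[leRHS]mul1r ler_pM ?invr_ge0//.
    by rewrite -[leRHS]mul1r ler_pM ?cos_max.
  have d0 : 0 < 4 * L%:R * sin x ^+ 2 by rewrite !mulr_gt0// exprn_gt0.
  have m20 : 0 < 4 * L%:R * m ^+ 2 by rewrite !mulr_gt0// exprn_gt0.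
  rewrite (gtr0_norm d0) lef_pV2 ?posrE// ler_pM2l ?mulr_gt0//.
  by rewrite ler_sqr ?nnegrE// ltW.
have w_le x : eta <= x <= pi / 2 -> `|w x| <= (4 * m)^-1 / L%:R.
  move=> /sin_m mx; have sx0 : 0 < sin x by exact: lt_le_trans mx.
  rewrite /w normrM normfV -invfM -[leRHS]mul1r ler_pM ?cos_max ?invr_ge0//.
  have d0 : 0 < 4 * L%:R * sin x by rewrite !mulr_gt0.
  rewrite (gtr0_norm d0) lef_pV2 ?posrE ?mulr_gt0//.
  by rewrite mulrAC ler_pM2l ?mulr_gt0.
have key : `|odd_sin_sum L (pi / 2) + w (pi / 2) - (odd_sin_sum L s + w s)| <=
    pi / 2 / (4 * m ^+ 2) / L%:R.
  change (`|(odd_sin_sum L + w) (pi / 2) - (odd_sin_sum L + w) s| <=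
    pi / 2 / (4 * m ^+ 2) / L%:R).
  have sub x : s <= x <= pi / 2 -> eta <= x <= pi / 2.
    by move=> /andP[sx ->]; rewrite (le_trans es sx).
  apply: (le_trans (mvt_le sp (fun x h => dU x (sub x h))
    (fun x h => dw_le x (sub x h)))).
  have -> : pi / 2 / (4 * m ^+ 2) / L%:R = (4 * L%:R * m ^+ 2)^-1 * (pi / 2).
    by field; rewrite !gt_eqF.
  have m20 : 0 < 4 * L%:R * m ^+ 2 by rewrite !mulr_gt0// exprn_gt0.
  by rewrite ler_pM2l ?invr_gt0//; lra.
have h1 : `|w (pi / 2)| <= (4 * m)^-1 / L%:R by apply: w_le; rewrite etap lexx.
have h2 : `|w s| <= (4 * m)^-1 / L%:R by apply: w_le; rewrite es sp.
rewrite [leRHS]mulrDl [X in _ <= X + _]mulrDl.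
have -> : odd_sin_sum L (pi / 2) - odd_sin_sum L s =
    odd_sin_sum L (pi / 2) + w (pi / 2) - (odd_sin_sum L s + w s) - w (pi / 2) + w s.
  ring.
rewrite (le_trans (ler_normD _ _))// lerD// (le_trans (ler_normB _ _))// lerD//.
Qed.

Let inv_small (x C : R) :
  (forall m : nat, (0 < m)%N -> x <= C / m%:R) -> x <= 0.
Proof.
move=> xC; rewrite leNgt; apply/negP => x0.
have C0 : 0 <= C by have := xC 1%N isT; rewrite divr1; lra.
have Cx : 0 <= C / x by rewrite divr_ge0// ltW.
have := archi_boundP Cx; set m := Num.bound _ => Cm.
have m0 : (0 < m)%N by rewrite -(ltr_nat R); exact: le_lt_trans Cm.
have := xC m m0; rewrite ler_pdivlMr ?ltr0n// => xm.
by move: Cm; rewrite ltr_pdivrMr// mulrC ltNge xm.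
Qed.

Let T (s : R) : R := limn (odd_cos_sum ^~ s).

Let cvgT s : odd_cos_sum L s @[L --> \oo] --> T s.
Proof.
apply: (nondecreasing_is_cvgn (odd_cos_sum_nondecreasing s)).
by exists 3 => _ [L _ <-]; exact: odd_cos_sum_le3.
Qed.

Let le_T L s : odd_cos_sum L s <= T s.
Proof.
by apply: nondecreasing_cvgn_le; [exact: odd_cos_sum_nondecreasing|exact: cvgT].
Qed.

Let T_le L s : (0 < L)%N -> T s <= odd_cos_sum L s + L%:R^-1.
Proof.
move=> L0; apply: (cvgr_to_le (@cvgT s)); near=> L'.
have LL' : (L <= L')%N by near: L'; exact: nbhs_infty_ge.
apply: (le_trans (odd_cos_sum_tail s L0 LL')).
by rewrite gerBl invr_ge0.
Unshelve. all: by end_near. Qed.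

Let p : R := pi / 2.

Let p_ge1 : 1 <= p. Proof. exact: pihalf_ge1. Qed.

Let G : R := (T p - T (p / 2)) / (p / 2).

(** All secants of [odd_cos_sum L] away from [0] have nearly the slope
    [odd_sin_sum L p]. This slope is eliminated between two secants, so its
    limit, which is [pi / 4], does not have to be evaluated. *)
Let T_affine a b : 0 < a -> a <= b -> b <= p -> T b - T a = (b - a) * G.
Proof.
move=> a0 ab bp; have p1 := p_ge1.
pose eta := Num.min a (p / 2).
have eta_p : 0 < eta <= pi / 2.
  by rewrite lt_min a0 ge_min -/p; apply/andP; split; lra.
have [ea ep2] : eta <= a /\ eta <= p / 2 by rewrite /eta !ge_min !lexx orbT.
have [K K0 gK] := odd_sin_sum_near eta_p.
have secant L x y : (0 < L)%N -> eta <= x -> x <= y -> y <= p ->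
    `|odd_cos_sum L y - odd_cos_sum L x - (y - x) * odd_sin_sum L p| <=
      (y - x) * (K / L%:R).
  move=> L0 ex xy yp.
  have [z /andP[xz zy] ->] := mvt_exists xy (fun x _ => is_derive_odd_cos_sum L x).
  rewrite mulrC -mulrBr normrM (@ger0_norm _ (y - x)) ?subr_ge0// distrC.
  by rewrite ler_wpM2l ?subr_ge0// gK// (le_trans ex xz) (le_trans zy yp).
pose e L := odd_cos_sum L b - odd_cos_sum L a -
  (b - a) * ((odd_cos_sum L p - odd_cos_sum L (p / 2)) / (p / 2)).
have e_cvg : `|e L| @[L --> \oo] --> `|T b - T a - (b - a) * G|.
  apply: cvg_norm; apply: cvgB; first by apply: cvgB; exact: cvgT.
  apply: cvgM; first exact: cvg_cst.
  apply: cvgM; last exact: cvg_cst.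
  by apply: cvgB; exact: cvgT.
have e_le L : (0 < L)%N -> `|e L| <= 2 * (b - a) * K / L%:R.
  move=> L0; have h1 := secant L a b L0 ea ab bp.
  have h2 := secant L (p / 2) p L0 ep2 _ (lexx _).
  have {}h2 := h2 ltac:(lra).
  have -> : e L = (odd_cos_sum L b - odd_cos_sum L a - (b - a) * odd_sin_sum L p) -
    (b - a) / (p / 2) * (odd_cos_sum L p - odd_cos_sum L (p / 2) -
      (p - p / 2) * odd_sin_sum L p).
    by rewrite /e; field; rewrite gt_eqF//; lra.
  apply: (le_trans (ler_normB _ _)).
  have -> : 2 * (b - a) * K / L%:R = (b - a) * (K / L%:R) +
      (b - a) / (p / 2) * ((p - p / 2) * (K / L%:R)).
    by field; rewrite !gt_eqF ?ltr0n//; lra.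
  rewrite lerD// normrM ger0_norm; last by rewrite divr_ge0 ?subr_ge0//; lra.
  by rewrite ler_wpM2l// divr_ge0 ?subr_ge0//; lra.
apply/eqP; rewrite -subr_eq0 -normr_le0.
apply: (@inv_small _ (2 * (b - a) * K)) => m m0.
apply: (cvgr_to_le e_cvg); near=> L.
have mL : (m <= L)%N by near: L; exact: nbhs_infty_ge.
have L0 : (0 < L)%N by exact: leq_trans mL.
apply: (le_trans (e_le L L0)).
rewrite ler_wpM2l ?mulr_ge0 ?subr_ge0//.
by rewrite lef_pV2 ?posrE ?ltr0n// ler_nat.
Unshelve. all: by end_near. Qed.

(** Continuity of [T] at [0] is read off from the estimates
    [L * a ^ 2 / 2 + 1 / L] at [a = b / L]. *)
Let T_linear b : 0 < b -> b <= p -> T b = b * G.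
Proof.
move=> b0 bp; apply/eqP; rewrite -subr_eq0 -normr_le0.
apply: (@inv_small _ (b ^+ 2 / 2 + 1 + b * `|G|)) => m m0.
have mR : 1 <= m%:R :> R by rewrite ler1n.
have mR0 : 0 < m%:R :> R by rewrite ltr0n.
pose a := b / m%:R; have a0 : 0 < a by rewrite divr_gt0.
have ab : a <= b by rewrite /a ler_pdivrMr// ler_peMr// ltW.
have -> : T b - b * G = T a - a * G.
  by have := T_affine a0 ab bp; lra.
have Ta0 : 0 <= T a by apply: le_trans (le_T 0 a); exact: odd_cos_sum_ge0.
have Ta : T a <= m%:R * (a ^+ 2 / 2) + m%:R^-1.
  by apply: (le_trans (T_le a m0)); rewrite lerD2r odd_cos_sum_le_quad.
apply: (le_trans (ler_normB _ _)).
rewrite ger0_norm// normrM gtr0_norm//.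
have -> : (b ^+ 2 / 2 + 1 + b * `|G|) / m%:R =
    m%:R * (a ^+ 2 / 2) + m%:R^-1 + a * `|G|.
  by rewrite /a; field; rewrite gt_eqF.
by rewrite lerD2r.
Qed.

(** The limit of the partial sums is proportional to [|s|] on
    $[-\pi/2,\pi/2]$. Away from that interval the bound holds because
    [s ^+ 2 >= `|s| >= 1] there. *)
Lemma triangle_wave : exists2 c, 0 < c & forall L s, (0 < L)%N ->
  `|c * `|s| - odd_cos_sum L s| <= L%:R^-1 + (c + 3) * s ^+ 2.
Proof.
have p1 := p_ge1.
have G0 : 0 < G.
  have Tp : 1 <= T p.
    apply: le_trans (le_T 1 p).
    by rewrite /odd_cos_sum big_ord1 /= mulr0 add0r expr1n divr1 mul1r cos_pihalf subr0.
  have := T_linear (lt_le_trans ltr01 p1) (lexx _) => TpE.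
  by move: Tp; rewrite TpE => pG; rewrite -(pmulr_rgt0 G (lt_le_trans ltr01 p1)); lra.
exists G => // L s L0; rewrite -odd_cos_sum_norm -(real_normK (num_real s)).
have := normr_ge0 s; move: `|s| => {}s s0.
have iL : 0 < L%:R^-1 :> R by rewrite invr_gt0 ltr0n.
have s2 : 0 <= (G + 3) * s ^+ 2 by rewrite mulr_ge0 ?sqr_ge0//; lra.
have [sp|ps] := leP s p; last first.
  have h3 := odd_cos_sum_le3 L s; have h0 := odd_cos_sum_ge0 L s.
  have s1 : 1 <= s by lra.
  have ss : s <= s ^+ 2 by rewrite expr2 ler_peMl.
  have Gs : G * s <= G * s ^+ 2 by rewrite ler_pM2l.
  have Gs0 : 0 <= G * s by rewrite mulr_ge0// ltW.
  rewrite ler_norml; apply/andP; split; lra.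
have TE : G * s = T s.
  move: s0; rewrite le_eqVlt => /predU1P[<-|s0]; last by rewrite T_linear// mulrC.
  rewrite mulr0; apply/le_anti/andP; split.
    by apply: le_trans (le_T 0 0); exact: odd_cos_sum_ge0.
  apply: (@inv_small _ 1) => m m0; apply: (le_trans (T_le 0 m0)).
  have := odd_cos_sum_le_quad m 0; rewrite expr0n /= mul0r mulr0 div1r; lra.
rewrite TE ger0_norm ?subr_ge0 ?le_T//.
by have := T_le s L0; lra.
Qed.

End triangle_wave.

(** * From 1 - cos to absolute values *)

Section odd_harmonic.
Context (R : realType).

Definition odd_harmonic (L : nat) : R := \sum_(l < L) (2 * l%:R + 1)^-1.

(** Each dyadic block of indices contributes at least [1 / 4]. *)
Lemma odd_harmonic_pow2 a : (a.+1)%:R / 4 <= odd_harmonic (2 ^ a) :> R.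
Proof.
elim: a => [|a IH].
  by rewrite expn0 /odd_harmonic big_ord1 /= mulr0 add0r invr1; lra.
rewrite expnS mul2n -addnn /odd_harmonic big_split_ord /= -/(odd_harmonic (2 ^ a)).
rewrite -[a.+2%:R]natr1 mulrDl lerD// div1r.
apply: (@le_trans _ _ (\sum_(l < 2 ^ a) (4 * 2 ^+ a)^-1)).
  rewrite sumr_const card_ord -[leRHS]mulr_natl natrX.
  rewrite le_eqVlt; apply/orP; left; apply/eqP; field.
  by rewrite gt_eqF// exprn_gt0.
apply: ler_sum => l _.
have h1 : 0 < 4 * 2 ^+ a :> R by rewrite mulr_gt0// exprn_gt0.
have h2 : 0 < 2 * (2 ^ a + l)%:R + 1 :> R by rewrite ltr_wpDl// mulr_ge0.
rewrite lef_pV2 ?posrE//.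
have : (2 ^ a + l < 2 ^ a + 2 ^ a)%N by rewrite ltn_add2l.
rewrite -(ler_nat R) -addn1 !natrD natrX; lra.
Qed.

Lemma odd_harmonic_ge1 L : (0 < L)%N -> 1 <= odd_harmonic L.
Proof.
case: L => // L _; rewrite /odd_harmonic big_ord_recl /= mulr0 add0r invr1 lerDl.
by apply: sumr_ge0 => l _; rewrite invr_ge0 addr_ge0// mulr_ge0.
Qed.

End odd_harmonic.

Lemma sqr_sum_le (R : realFieldType) (n : nat) (u : 'I_n -> R) :
  (\sum_i u i) ^+ 2 <= n%:R * \sum_i u i ^+ 2.
Proof.
have -> : n%:R * \sum_i u i ^+ 2 = \sum_i \sum_j (u i ^+ 2 + u j ^+ 2) / 2.
  set S := \sum_i u i ^+ 2.
  have inner i : \sum_j (u i ^+ 2 + u j ^+ 2) / 2 = (n%:R * u i ^+ 2 + S) / 2.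
    by rewrite -mulr_suml big_split /= sumr_const card_ord -[_ *+ n]mulr_natl.
  under [RHS]eq_bigr do rewrite inner.
  rewrite -mulr_suml big_split /= -mulr_sumr sumr_const card_ord.
  by rewrite -[S *+ n]mulr_natl -/S; field.
rewrite expr2 mulr_suml; apply: ler_sum => i _; rewrite mulr_sumr.
apply: ler_sum => j _; have := sqr_ge0 (u i - u j); rewrite sqrrB; lra.
Qed.

Section spectral_approximation.
Context (R : realType) (n : nat).
Variable N : 'rV[R]_n -> R.
Hypothesis NZ : forall a x, N (a *: x) = `|a| * N x.
Hypothesis ND : forall x y, N (x + y) <= N x + N y.
Hypothesis psdN : psd_kernel (fun x y => expR (- N (x - y))).

Let Ne i := N (delta_mx 0 i).
Let ez i : 'rV[int]_n := delta_mx 0 i.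

Let Ne_ge0 i : 0 <= Ne i. Proof. exact: seminorm_ge0. Qed.

Let z2r_ez i : z2r R (ez i) = delta_mx 0 i.
Proof. by apply/rowP => j; rewrite !mxE; case: (_ && _). Qed.

Let dotz_ez i (th : 'rV[R]_n) : dotz (ez i) th = th 0 i.
Proof.
rewrite /dotz (bigD1 i)//= !mxE !eqxx mul1r big1 ?addr0// => j ji.
by rewrite mxE eqxx (negPf ji) mul0r.
Qed.

(** The representation is used for [(2 l + 1) z] with [l < 2 ^ a] and [z] in
    the cube of side [2 ^ a], whence its range. *)
Section scale.
Variables (a : nat) (J : finType) (p : J -> R) (th : J -> 'rV[R]_n).
Let L := (2 ^ a)%N.
Let delta : R := L%:R^-1.
Hypothesis p_ge0 : forall j, 0 <= p j.
Hypothesis th_pi : forall j i, `|th j 0 i| <= pi.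
Hypothesis repr : forall z : 'rV[int]_n,
  (forall i, `|z 0 i| <= (2 * 2 ^ a * 2 ^ a)%N%:Z) ->
  `|N (z2r R z) - \sum_j p j * (1 - cos (dotz z (th j)))| <= delta.

Let L_gt0 : 0 < L%:R :> R. Proof. by rewrite ltr0n expn_gt0. Qed.

Let delta_le1 : delta <= 1.
Proof. by rewrite invf_le1// ler1n expn_gt0. Qed.

Let coord k i : (k <= 2 * 2 ^ a)%N ->
  \sum_j p j * (1 - cos (k%:R * th j 0 i)) <= k%:R * Ne i + delta.
Proof.
move=> ka.
have /repr : forall i', `|(k%:Z *: ez i) 0 i'| <= (2 * 2 ^ a * 2 ^ a)%N%:Z.
  move=> i'; rewrite !mxE eqxx /=; apply: (@le_trans _ _ k%:Z).
    by case: eqP => _; rewrite ?mulr1 ?mulr0.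
  by rewrite lez_nat (leq_trans ka)// leq_pmulr// expn_gt0.
rewrite z2rZ NZ z2r_ez (@ger0_norm _ (k%:Z%:~R))// -/(Ne i) ler_norml => /andP[h _].
move: h; under eq_bigr do rewrite dotz_scale dotz_ez.
by rewrite -[k%:Z%:~R]/(k%:R); lra.
Qed.

(** Dyadic decomposition: if [2^-b < |t| <= pi] then some dyadic multiple of
    [t] with exponent at most [b.+1] lies where [1 - cos >= 1]. *)
Let dyadic b (t : R) : `|t| <= pi -> (2 ^+ b)^-1 < `|t| ->
  1 <= \sum_(k < b.+2) (1 - cos (2 ^+ k * t)).
Proof.
move=> tpi bt.
have term0 (k : nat) : 0 <= 1 - cos (2 ^+ k * t) by rewrite subr_ge0 cos_le1.
have exk : exists k : nat, pi / 2 <= 2 ^+ k * `|t|.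
  exists b.+1; rewrite exprS; have := @pihalf_lt2 R.
  have : 1 < 2 ^+ b * `|t| by rewrite -ltr_pdivrMl ?mulr1// exprn_gt0.
  lra.
case: (ex_minnP exk) => k kt kmin.
have kb : (k < b.+2)%N.
  rewrite ltnS; apply: kmin; rewrite exprS; have := @pihalf_lt2 R.
  have : 1 < 2 ^+ b * `|t| by rewrite -ltr_pdivrMl ?mulr1// exprn_gt0.
  lra.
rewrite (bigD1 (Ordinal kb))//= -[leLHS]addr0 lerD//; last by apply: sumr_ge0.
rewrite lerDl oppr_ge0.
have -> : cos (2 ^+ k * t) = cos (2 ^+ k * `|t|).
  by rewrite -cos_norm normrM ger0_norm// exprn_ge0.
have kpi : 2 ^+ k * `|t| <= pi.
  case: k kt kmin {kb} => [|k] kt kmin; first by rewrite expr0 mul1r.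
  have : 2 ^+ k * `|t| < pi / 2.
    by rewrite ltNge; apply/negP => /kmin; rewrite ltnn.
  rewrite exprS; lra.
have -> : 2 ^+ k * `|t| = (2 ^+ k * `|t| - pi / 2) + pi / 2 by rewrite subrK.
rewrite cosDpihalf oppr_le0 sin_ge0_pi//; apply/andP.
by have := @pi_ge0 R; split; lra.
Qed.

(** The mass of frequencies above [2 ^- b] is read off by evaluating the
    representation of [N] at the vectors [2 ^ k e_i] with [k <= b + 1]. *)
Let mass_tail b i : (b <= a)%N ->
  \sum_(j | (2 ^+ b)^-1 < `|th j 0 i|) p j <= 2 ^+ b * (4 * Ne i + 2).
Proof.
move=> ba.
apply: (@le_trans _ _ (\sum_(k < b.+2) \sum_j p j * (1 - cos (2 ^+ k * th j 0 i)))).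
  rewrite exchange_big /= [leLHS]big_mkcond /=; apply: ler_sum => j _.
  rewrite -mulr_sumr; case: ifPn => [bt|_].
    by rewrite ler_peMr// dyadic.
  rewrite mulr_ge0//; apply: sumr_ge0 => k _.
  by rewrite subr_ge0 cos_le1.
apply: (@le_trans _ _ (\sum_(k < b.+2) (2 ^+ k * Ne i + 1))).
  apply: ler_sum => k _; have := @coord (2 ^ k) i; rewrite natrX => h.
  apply: le_trans (h _) _; last by rewrite lerD2l.
  by rewrite -expnS leq_pexp2l//; have := ltn_ord k; lia.
rewrite big_split /= sumr_const card_ord -mulr_suml.
have -> : \sum_(k < b.+2) 2 ^+ k = 4 * 2 ^+ b - 1 :> R.
  elim: b {ba} => [|b IH]; first by rewrite !big_ord_recr big_ord0 /= expr0 expr1; lra.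
  by rewrite big_ord_recr /= IH !exprS; ring.
have : (b.+2)%:R <= 2 * 2 ^+ b :> R.
  rewrite -exprS -natrX ler_nat; elim: b {ba} => // b IH.
  rewrite expnS mul2n -addnn (leq_trans (n := (b.+2 + 1)%N)) ?addn1//.
  by rewrite -addn1 leq_add// expn_gt0.
have := Ne_ge0 i; have : 0 < 2 ^+ b :> R by rewrite exprn_gt0.
lra.
Qed.

(** Below [2 ^- b] the quadratic lower bound on [1 - cos] applies at the vector
    [2 ^ b e_i]. *)
Let second_moment b i : (b <= a)%N ->
  \sum_(j | `|th j 0 i| <= (2 ^+ b)^-1) p j * th j 0 i ^+ 2 <=
    8 * (Ne i + 1) / 2 ^+ b.
Proof.
move=> ba; have b0 : 0 < 2 ^+ b :> R by rewrite exprn_gt0.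
have b1 : 1 <= 2 ^+ b :> R by rewrite exprn_ege1// ler1n.
apply: (@le_trans _ _ (8 / (2 ^+ b) ^+ 2 *
    \sum_j p j * (1 - cos (2 ^+ b * th j 0 i)))).
  rewrite mulr_sumr [leLHS]big_mkcond /=; apply: ler_sum => j _.
  case: ifPn => [jb|_]; last first.
    by rewrite mulr_ge0 ?divr_ge0 ?exprn_ge0 ?(ltW b0)// mulr_ge0// subr_ge0 cos_le1.
  have : `|2 ^+ b * th j 0 i| <= 1.
    by rewrite normrM (gtr0_norm b0) -ler_pdivlMl// mulr1.
  move=> /cos_ge_quad; rewrite exprMn => h.
  rewrite [leRHS]mulrCA ler_wpM2l// -ler_pdivrMl ?divr_gt0 ?exprn_gt0//.
  apply: le_trans h; rewrite le_eqVlt; apply/orP; left; apply/eqP; field.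
  by rewrite gt_eqF.
have := @coord (2 ^ b) i; rewrite natrX => h.
have {}h := h _; apply: (le_trans (ler_wpM2l _ (h _))).
- by rewrite divr_ge0// exprn_ge0// ltW.
- by rewrite -expnS leq_pexp2l// ltnW// ltnS.
have -> : 8 * (Ne i + 1) / 2 ^+ b =
    8 / (2 ^+ b) ^+ 2 * (2 ^+ b * Ne i + 2 ^+ b) by field; rewrite gt_eqF.
rewrite ler_wpM2l ?divr_ge0 ?exprn_ge0 ?(ltW b0)// lerD2l.
exact: le_trans b1.
Qed.

Let moment_bound i : R := 8 * (Ne i + 1) + pi ^+ 2 * (4 * Ne i + 2).

Let full_second_moment i : \sum_j p j * th j 0 i ^+ 2 <= moment_bound i.
Proof.
rewrite (bigID (fun j => `|th j 0 i| <= 1)) /=; apply: lerD.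
  by have := second_moment i (leq0n a); rewrite expr0 invr1 mulr1.
apply: (@le_trans _ _ (\sum_(j | ~~ (`|th j 0 i| <= 1)) p j * pi ^+ 2)).
  apply: ler_sum => j _; rewrite ler_wpM2l// -(real_normK (num_real (th j 0 i))).
  by rewrite ler_sqr ?nnegrE// pi_ge0.
rewrite -mulr_suml mulrC ler_wpM2l ?sqr_ge0//.
have := mass_tail i (leq0n a); rewrite expr0 invr1 mul1r => h.
apply: le_trans h; rewrite le_eqVlt; apply/orP; left; apply/eqP.
by apply: eq_bigl => j; rewrite ltNge.
Qed.

Variable c : R.
Hypothesis c_gt0 : 0 < c.
Hypothesis c_wave : forall L s, (0 < L)%N ->
  `|c * `|s| - odd_cos_sum L s| <= L%:R^-1 + (c + 3) * s ^+ 2.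

Let big j := [exists i, (2 ^+ a)^-1 < `|th j 0 i|].

Let sq (z : 'rV[int]_n) : R := n%:R * \sum_i (z 0 i)%:~R ^+ 2.

Let sq_ge0 (z : 'rV[int]_n) : 0 <= sq z.
Proof. by rewrite mulr_ge0// sumr_ge0// => i _; exact: sqr_ge0. Qed.

Let dotz_sqr (z : 'rV[int]_n) j : dotz z (th j) ^+ 2 <= sq z * \sum_i th j 0 i ^+ 2.
Proof.
apply: (le_trans (sqr_sum_le _)); rewrite /sq -mulrA ler_wpM2l//.
rewrite mulr_sumr; apply: ler_sum => i _; rewrite exprMn ler_wpM2r ?sqr_ge0//.
rewrite (bigD1 i)//= lerDl; apply: sumr_ge0 => k _; exact: sqr_ge0.
Qed.

Definition spectral_error (z : 'rV[int]_n) : R :=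
  1 + sq z * \sum_i (4 * (Ne i + 1)) + \sum_i (4 * Ne i + 2) +
  (c + 3) * (sq z * \sum_i moment_bound i).

(** Homogeneity: [N z / k = N (k z) / k ^ 2], summed over the odd [k]. *)
Let wave_average (z : 'rV[int]_n) : (forall i, `|z 0 i| <= (2 ^ a)%N%:Z) ->
  `|odd_harmonic R L * N (z2r R z) - \sum_j p j * odd_cos_sum L (dotz z (th j))| <= 1.
Proof.
move=> za.
have -> : \sum_j p j * odd_cos_sum L (dotz z (th j)) = \sum_(l < L)
    (\sum_j p j * (1 - cos (dotz ((2 * l + 1)%N%:Z *: z) (th j)))) /
      (2 * l%:R + 1) ^+ 2.
  under [RHS]eq_bigr do rewrite mulr_suml.
  rewrite exchange_big /=; apply: eq_bigr => j _; rewrite mulr_sumr.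
  apply: eq_bigr => l _; rewrite dotz_scale mulrA.
  by rewrite -[(2 * l + 1)%N%:Z%:~R]/((2 * l + 1)%N%:R) natrD natrM.
rewrite /odd_harmonic mulr_suml -sumrB (le_trans (ler_norm_sum _ _ _))//.
apply: (@le_trans _ _ (\sum_(l < L) delta)); last first.
  by rewrite sumr_const card_ord -[leLHS]mulr_natl /delta divff// gt_eqF.
apply: ler_sum => l _.
have l0 : 1 <= 2 * l%:R + 1 :> R by rewrite lerDr mulr_ge0.
have l0' : 0 < 2 * l%:R + 1 :> R by exact: lt_le_trans l0.
have -> : (2 * l%:R + 1)^-1 * N (z2r R z) =
    N (z2r R ((2 * l + 1)%N%:Z *: z)) / (2 * l%:R + 1) ^+ 2.
  rewrite z2rZ NZ -[(2 * l + 1)%N%:Z%:~R]/((2 * l + 1)%N%:R) ger0_norm//.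
  by rewrite natrD natrM; field; rewrite gt_eqF.
rewrite -mulrBl normrM; apply: (@le_trans _ _ (delta * 1)); last by rewrite mulr1.
apply: ler_pM => //.
  apply: repr => i; rewrite mxE normrM.
  rewrite (le_trans (ler_wpM2l _ (za i)))//.
  rewrite (@ger0_norm _ (2 * l + 1)%N%:Z)// -PoszM lez_nat leq_mul2r; apply/orP; right.
  by have := ltn_ord l; rewrite /L; lia.
rewrite normfV invf_le1; last by rewrite normr_gt0 gt_eqF// exprn_gt0.
by rewrite ger0_norm ?exprn_ege1// exprn_ge0// ltW.
Qed.

(** Small frequencies contribute [O(1)] because [odd_cos_sum L] is quadratic
    there, large ones because it differs from [c |s|] by [O(1 / L + s ^+ 2)]. *)
Lemma spectral_estimate (z : 'rV[int]_n) : (forall i, `|z 0 i| <= (2 ^ a)%N%:Z) ->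
  `|odd_harmonic R L * N (z2r R z) -
    c * \sum_(j | big j) p j * `|dotz z (th j)| | <= spectral_error z.
Proof.
move=> za; have h1 := wave_average za.
have L0 : (0 < L)%N by rewrite expn_gt0.
have a0 : 0 < 2 ^+ a :> R by rewrite exprn_gt0.
have LE : L%:R = 2 ^+ a :> R by rewrite /L natrX.
pose S := \sum_(j | big j) p j * odd_cos_sum L (dotz z (th j)).
pose S' := \sum_(j | ~~ big j) p j * odd_cos_sum L (dotz z (th j)).
have SS : \sum_j p j * odd_cos_sum L (dotz z (th j)) = S + S'.
  by rewrite (bigID big).
have S'0 : 0 <= S'.
  by apply: sumr_ge0 => j _; rewrite mulr_ge0// odd_cos_sum_ge0.
have S'_le : S' <= sq z * \sum_i (4 * (Ne i + 1)).
  apply: (@le_trans _ _ (\sum_(j | ~~ big j)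
      2 ^+ a / 2 * sq z * \sum_i p j * th j 0 i ^+ 2)).
    apply: ler_sum => j _; rewrite -mulr_sumr [leRHS]mulrCA ler_wpM2l//.
    rewrite (le_trans (odd_cos_sum_le_quad _ _))// LE.
    have -> : 2 ^+ a / 2 * sq z * \sum_i th j 0 i ^+ 2 =
        2 ^+ a * (sq z * (\sum_i th j 0 i ^+ 2) / 2) by ring.
    by rewrite ler_pM2l// ler_pM2r ?invr_gt0// dotz_sqr.
  rewrite -mulr_sumr exchange_big /=.
  have -> : sq z * \sum_i (4 * (Ne i + 1)) =
      2 ^+ a / 2 * sq z * \sum_i (8 * (Ne i + 1) / 2 ^+ a).
    rewrite !mulr_sumr; apply: eq_bigr => i _; field.
    by rewrite gt_eqF.
  have k0 : 0 <= 2 ^+ a / 2 * sq z.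
    by apply: mulr_ge0; [rewrite divr_ge0// ltW|exact: sq_ge0].
  apply: (ler_wpM2l k0).
  apply: ler_sum => i _; apply: le_trans (second_moment i (leqnn a)).
  rewrite big_mkcond [leRHS]big_mkcond /=; apply: ler_sum => j _.
  case: ifPn => [|_]; last by case: ifP => // _; rewrite mulr_ge0// sqr_ge0.
  by rewrite negb_exists => /forallP /(_ i); rewrite -leNgt => ->.
have S_le : `|c * \sum_(j | big j) p j * `|dotz z (th j)| - S| <=
    \sum_i (4 * Ne i + 2) + (c + 3) * (sq z * \sum_i moment_bound i).
  rewrite mulr_sumr -sumrB (le_trans (ler_norm_sum _ _ _))//.
  apply: (@le_trans _ _ (\sum_(j | big j) (p j / 2 ^+ a +
      (c + 3) * (sq z * \sum_i p j * th j 0 i ^+ 2)))).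
    apply: ler_sum => j _; rewrite mulrCA -mulrBr normrM ger0_norm//.
    have -> : p j / 2 ^+ a + (c + 3) * (sq z * \sum_i p j * th j 0 i ^+ 2) =
        p j * ((2 ^+ a)^-1 + (c + 3) * (sq z * \sum_i th j 0 i ^+ 2)).
      by rewrite -mulr_sumr; ring.
    rewrite ler_wpM2l// (le_trans (c_wave _ L0))// LE lerD2l ler_wpM2l ?dotz_sqr//.
    by rewrite addr_ge0// ltW.
  rewrite big_split /=; apply: lerD.
    apply: (@le_trans _ _ (\sum_i \sum_(j | (2 ^+ a)^-1 < `|th j 0 i|) p j / 2 ^+ a)).
      under [leRHS]eq_bigr do rewrite big_mkcond; rewrite exchange_big /=.
      rewrite big_mkcond /=; apply: ler_sum => j _; case: ifPn => [/existsP[i bi]|_].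
        rewrite (bigD1 i)//= bi lerDl; apply: sumr_ge0 => k _.
        by case: ifP => // _; rewrite divr_ge0// ltW.
      by apply: sumr_ge0 => k _; case: ifP => // _; rewrite divr_ge0// ltW.
    apply: ler_sum => i _; rewrite -mulr_suml ler_pdivrMr// mulrC.
    exact: mass_tail.
  rewrite -mulr_sumr -mulr_sumr ler_wpM2l ?addr_ge0 ?(ltW c_gt0)//.
  rewrite ler_wpM2l// exchange_big /=; apply: ler_sum => i _.
  apply: le_trans (full_second_moment i).
  rewrite [leRHS](bigID big) /= lerDl; apply: sumr_ge0 => j _.
  by rewrite mulr_ge0// sqr_ge0.
move: h1 S_le; rewrite SS /spectral_error !ler_norml => /andP[h1 h1'] /andP[h2 h2'].
apply/andP; split; lra.
Qed.

End scale.

(** The mass of the approximating measure is controlled by evaluating the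
    approximation at the coordinate vectors; the slack is put at the origin so
    that the total mass is exactly one. *)
Lemma spectral_approximation : exists (B : R) (C : 'rV[int]_n -> R),
  forall a : nat, exists (J : finType) (w : J -> R) (xi : J -> 'rV[R]_n),
    [/\ forall j, 0 <= w j, \sum_j w j = 1, forall j i, `|xi j 0 i| <= B &
      forall z : 'rV[int]_n, (forall i, `|z 0 i| <= (2 ^ a)%N%:Z) ->
        `|N (z2r R z) - \sum_j w j * `|dotz z (xi j)| | <= C z / a.+1%:R].
Proof.
have [c c0 c_wave] := triangle_wave R.
pose E (z : 'rV[int]_n) := spectral_error c z.
pose B := \sum_i (Ne i + `|E (ez i)|) + 1.
have B0 : 0 < B by rewrite ltr_wpDl// sumr_ge0// => i _; rewrite addr_ge0.
exists B, (fun z => 4 * E z) => a.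
have L0 : (0 < 2 ^ a)%N by rewrite expn_gt0.
have [J [p [th [p0 th_pi repr]]]] := seminorm_approx NZ ND psdN
  (2 * 2 ^ a * 2 ^ a)
  (delta := (2 ^ a)%:R^-1) ltac:(by rewrite invr_gt0 ltr0n).
have est := spectral_estimate p0 th_pi repr c0 c_wave.
pose A := odd_harmonic R (2 ^ a).
have A1 : 1 <= A := odd_harmonic_ge1 R L0.
have Aa : (a.+1)%:R / 4 <= A := odd_harmonic_pow2 R a.
have A0 : 0 < A := lt_le_trans ltr01 A1.
pose big j := [exists i, (2 ^+ a)^-1 < `|th j 0 i|].
pose rho j := \sum_i `|th j 0 i|.
have rho_ge j i : `|th j 0 i| <= rho j.
  by rewrite /rho (bigD1 i)//= lerDl sumr_ge0.
have rho0 j : 0 <= rho j by exact: sumr_ge0.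
have rho_big j : big j -> 0 < rho j.
  move=> /existsP[i bi]; apply: lt_le_trans (rho_ge j i).
  by apply: le_lt_trans bi; rewrite invr_ge0 exprn_ge0.
(* Frequencies are normalized to the unit cube by their l1 norm [rho], which
   goes into the weight, and then rescaled by the bound [B] on the mass. *)
pose w j := if big j then c * p j * rho j / A else 0.
have w0 j : 0 <= w j.
  by rewrite /w; case: ifP => // _; rewrite divr_ge0 ?mulr_ge0 ?(ltW c0) ?(ltW A0).
have wB : \sum_j w j <= B.
  have -> : \sum_j w j = \sum_i (c * \sum_(j | big j) p j * `|dotz (ez i) (th j)|) / A.
    rewrite -big_mkcond /=; under [RHS]eq_bigr do rewrite mulr_sumr mulr_suml.
    rewrite exchange_big /=; apply: eq_bigr => j _; rewrite mulr_sumr mulr_suml.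
    by apply: eq_bigr => i _; rewrite dotz_ez; ring.
  apply: (@le_trans _ _ (\sum_i (Ne i + `|E (ez i)|))); last by rewrite lerDl.
  apply: ler_sum => i _; rewrite ler_pdivrMr//.
  have eza k : `|ez i 0 k| <= (2 ^ a)%N%:Z.
    by rewrite mxE; case: (_ && _) => //; rewrite normr1 lez_nat.
  have := est (ez i) eza; rewrite z2r_ez -/(Ne i) -/A -/(E (ez i)).
  rewrite ler_norml => /andP[+ _].
  have := ler_norm (E (ez i)); have := normr_ge0 (E (ez i)).
  have := Ne_ge0 i; nra.
exists [the finType of (J + unit)%type],
  (fun j => match j with inl j => w j / B | inr _ => 1 - (\sum_j w j) / B end),
  (fun j => match j with inl j => (B / rho j) *: th j | inr _ => 0 end).
split=> [[j|_]||[j|_] i|z za].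
- by rewrite divr_ge0// ltW.
- by rewrite subr_ge0 ler_pdivrMr// mul1r.
- rewrite big_sumType /= -mulr_suml (big_pred1 tt) => [|[]]//.
  by rewrite addrC subrK.
- rewrite mxE normrM normrM normfV (gtr0_norm B0) (ger0_norm (rho0 j)).
  have := rho0 j; rewrite le_eqVlt => /predU1P[<-|rj].
    by rewrite invr0 mulr0 mul0r ltW.
  by rewrite mulrAC ler_pdivrMr// ler_pM2l.
- by rewrite mxE normr0 ltW.
rewrite big_sumType /= (big_pred1 tt) => [|[]]//.
rewrite /dotz [X in _ + _ * `|X|]big1 => [|i _]; last by rewrite mxE mulr0.
rewrite normr0 mulr0 addr0.
have -> : \sum_j w j / B * `|\sum_i (z 0 i)%:~R * ((B / rho j) *: th j) 0 i| =
    (c * \sum_(j | big j) p j * `|dotz z (th j)|) / A.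
  rewrite mulr_sumr mulr_suml [RHS]big_mkcond /=; apply: eq_bigr => j _.
  rewrite /w; case: ifPn => [bj|_]; last by rewrite !mul0r.
  have rj := rho_big j bj.
  have -> : \sum_i (z 0 i)%:~R * ((B / rho j) *: th j) 0 i = B / rho j * dotz z (th j).
    by rewrite mulr_sumr; apply: eq_bigr => i _; rewrite mxE; ring.
  rewrite normrM (@gtr0_norm _ (B / rho j)) ?divr_gt0//.
  by field; rewrite !gt_eqF.
have {est} := est z za; rewrite -/A -/(E z) => est.
have -> : N (z2r R z) - (c * \sum_(j | big j) p j * `|dotz z (th j)|) / A =
    (A * N (z2r R z) - c * \sum_(j | big j) p j * `|dotz z (th j)|) / A.
  by field; rewrite gt_eqF.
rewrite normrM normfV (gtr0_norm A0) ler_pdivrMr//.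
apply: (le_trans est).
have E0 : 0 <= E z := le_trans (normr_ge0 _) est.
have a0 : 0 < a.+1%:R :> R by rewrite ltr0n.
have -> : 4 * E z / a.+1%:R * A = E z * (4 * A / a.+1%:R) by ring.
rewrite ler_peMr// ler_pdivlMr// mul1r; lra.
Qed.

End spectral_approximation.

(** * Means as limits of discrete measures *)

Section means.
Context (R : realType) (X : Type).

Definition bounded_real (F : X -> R) := exists K : R, forall x, `|F x| <= K.

(** A mean is a finitely additive probability on [X], given as a functional. *)
Record is_mean (E : (X -> R) -> R) : Prop := {
  mean_lin : forall a F G, bounded_real F -> bounded_real G ->
    E (fun x => a * F x + G x) = a * E F + E G;
  mean_ge0 : forall F, bounded_real F -> (forall x, 0 <= F x) -> 0 <= E F;
  mean1 : E (fun=> 1) = 1 }.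

Lemma bounded_real_cst (c : R) : bounded_real (fun=> c).
Proof. by exists `|c|. Qed.

Lemma bounded_realD F G : bounded_real F -> bounded_real G ->
  bounded_real (fun x => F x + G x).
Proof.
move=> [K hK] [K' hK']; exists (K + K') => x.
by rewrite (le_trans (ler_normD _ _))// lerD.
Qed.

Lemma bounded_realZ (c : R) F : bounded_real F -> bounded_real (fun x => c * F x).
Proof. by move=> [K hK]; exists (`|c| * K) => x; rewrite normrM ler_wpM2l. Qed.

Lemma bounded_real_norm F : bounded_real F -> bounded_real (fun x => `|F x|).
Proof. by move=> [K hK]; exists K => x; rewrite normr_id. Qed.

Lemma bounded_real_sum (J : Type) (s : seq J) (P : pred J) (F : J -> X -> R) :
  (forall j, bounded_real (F j)) ->
  bounded_real (fun x => \sum_(j <- s | P j) F j x).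
Proof.
move=> bF; elim: s => [|j s [K hK]].
  by exists 0 => x; rewrite big_nil normr0.
have [K' hK'] := bF j; exists (K' + K) => x; rewrite big_cons.
have K0 : 0 <= K' := le_trans (normr_ge0 _) (hK' x).
by case: ifP => _; [rewrite (le_trans (ler_normD _ _))// lerD|rewrite ler_wpDl].
Qed.

Lemma bounded_real_bool (b : X -> bool) : bounded_real (fun x => (b x)%:R).
Proof. by exists 1 => x; case: (b x); rewrite ?normr1 ?normr0. Qed.

Variables (E : (X -> R) -> R) (mE : is_mean E).

Lemma mean0 : E (fun=> 0) = 0.
Proof.
have := mean_lin mE (-1) (bounded_real_cst 1) (bounded_real_cst 1).
by rewrite mulN1r addNr mean1// mulN1r addNr.
Qed.

Lemma meanZ c F : bounded_real F -> E (fun x => c * F x) = c * E F.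
Proof.
move=> bF; have := mean_lin mE c bF (bounded_real_cst 0).
rewrite mean0 addr0 => <-; congr E; apply/funext => x; by rewrite addr0.
Qed.

Lemma meanD F G : bounded_real F -> bounded_real G ->
  E (fun x => F x + G x) = E F + E G.
Proof.
move=> bF bG; have := mean_lin mE 1 bF bG; rewrite mul1r => <-.
by congr E; apply/funext => x; rewrite mul1r.
Qed.

Lemma meanB F G : bounded_real F -> bounded_real G ->
  E (fun x => F x - G x) = E F - E G.
Proof.
move=> bF bG; have := mean_lin mE (-1) bG bF; rewrite mulN1r addrC => <-.
by congr E; apply/funext => x; rewrite mulN1r addrC.
Qed.

Lemma mean_cst c : E (fun=> c) = c.
Proof.
rewrite -[RHS]mulr1 -(mean1 mE) -meanZ; last exact: bounded_real_cst.
by congr E; apply/funext => x; rewrite mulr1.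
Qed.

Lemma mean_sum (J : Type) (s : seq J) (F : J -> X -> R) :
  (forall j, bounded_real (F j)) ->
  E (fun x => \sum_(j <- s) F j x) = \sum_(j <- s) E (F j).
Proof.
move=> bF; elim: s => [|j s IH].
  by rewrite big_nil -[RHS]mean0; congr E; apply/funext => x; rewrite big_nil.
rewrite big_cons -IH -meanD//; last exact: bounded_real_sum.
by congr E; apply/funext => x; rewrite big_cons.
Qed.

Lemma le_mean F G : bounded_real F -> bounded_real G ->
  (forall x, F x <= G x) -> E F <= E G.
Proof.
move=> bF bG FG; rewrite -subr_ge0 -meanB//; apply: (mean_ge0 mE) => [|x].
  apply: bounded_realD => //; have := bounded_realZ (-1) bF.
  by congr bounded_real; apply/funext => x; rewrite mulN1r.
by rewrite subr_ge0.
Qed.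

Lemma mean_dist_le F G e : bounded_real F -> bounded_real G ->
  (forall x, `|F x - G x| <= e) -> `|E F - E G| <= e.
Proof.
move=> bF bG FG; rewrite ler_distl; apply/andP; split.
- rewrite -(mean_cst e) -meanB//; last exact: bounded_real_cst.
  apply: le_mean => [||x]//; last first.
    by have := FG x; rewrite ler_distl => /andP[].
  apply: bounded_realD => //; exact: bounded_real_cst.
- rewrite -[X in _ <= _ + X](mean_cst e) -meanD//; last exact: bounded_real_cst.
  apply: le_mean => [||x]//; last first.
    by have := FG x; rewrite ler_distl => /andP[].
  apply: bounded_realD => //; exact: bounded_real_cst.
Qed.

End means.

(** An ultrafilter containing a compact set converges; this is applied to the
    image of [U], which contains [-K, K]. *)
Lemma bounded_cvg_ultra (R : realType) (S : Type) (U : set_system S) (u : S -> R)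
    (K : R) :
  UltraFilter U -> (\forall t \near U, `|u t| <= K) -> cvg (u @ U).
Proof.
move=> ultU uK.
have ultu : UltraFilter (u @ U).
  split; first exact: fmap_proper_filter.
  move=> G pG uG; apply/seteqP; split => // A GA.
  have [//|UA] := in_ultra_setVsetC (u @^-1` A) ultU.
  have GnA : G (~` A) by exact: uG.
  by have := filter_ex (filterI GA GnA) => -[x []].
have := @segment_compact R (- K) K; rewrite compact_ultra => /(_ _ ultu).
have uKK : (u @ U) `[- K, K]%classic.
  by apply: filterS uK => t; rewrite /= in_itv /= -ler_norml.
by move=> /(_ uKK) [l [_ ul]]; apply/cvg_ex; exists l.
Qed.

(** A limit along an ultrafilter turns discrete measures of mass one into a
    mean, without extracting subsequences. *)
Lemma ultra_mean (R : realType) (X : Type) (J : nat -> finType)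
    (w : forall a, J a -> R) (x : forall a, J a -> X) :
  (forall a j, 0 <= w a j) -> (forall a, \sum_j w a j = 1) ->
  exists2 E, is_mean E & forall F l, bounded_real F ->
    \sum_j w a j * F (x a j) @[a --> \oo] --> l -> E F = l.
Proof.
move=> w0 w1; have [U [ultU ooU]] := @ultraFilterLemma nat \oo _.
pose e (F : X -> R) a := \sum_j w a j * F (x a j).
have cvge F : bounded_real F -> cvg (e F @ U).
  move=> [K FK]; apply: (@bounded_cvg_ultra _ _ _ _ K); apply: filterE => a.
  rewrite (le_trans (ler_norm_sum _ _ _))// -[leRHS]mul1r -(w1 a) mulr_suml.
  by apply: ler_sum => j _; rewrite normrM ger0_norm// ler_wpM2l.
exists (fun F => lim (e F @ U)); first split.
- move=> a F G bF bG; apply/cvg_lim => //.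
  rewrite (_ : e _ = fun k => a * e F k + e G k); last first.
    apply/funext => k; rewrite /e mulr_sumr -big_split /=.
    by apply: eq_bigr => j _; ring.
  by apply: cvgD; [apply: cvgM; [exact: cvg_cst|exact: cvge]|exact: cvge].
- move=> F bF F0; apply: limr_ge; first exact: cvge.
  by apply: filterE => a; apply: sumr_ge0 => j _; rewrite mulr_ge0.
- apply/cvg_lim => //; rewrite (_ : e _ = fun=> 1); first exact: cvg_cst.
  by apply/funext => a; rewrite /e -[RHS](w1 a); apply: eq_bigr => j _; rewrite mulr1.
- by move=> F l bF Fl; apply/cvg_lim => //; apply: cvg_trans Fl; exact: cvg_app.
Qed.

(** * Realizing a mean on the unit interval *)

Lemma lebesgue01_itv (R : realType) (a b : R) : 0 <= a -> a <= b -> b <= 1 ->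
  @lebesgue01 R `[a, b[%classic = (b - a)%:E.
Proof.
move=> a0 ab b1; rewrite /lebesgue01 /mrestr setIidl; last first.
  move=> t /=; rewrite !in_itv /= => /andP[at_ tb]; apply/andP; split; lra.
rewrite lebesgue_measure_itv /= lte_fin; case: ltP => // ba.
by congr EFin; lra.
Qed.

Lemma lebesgue01_setT (R : realType) : @lebesgue01 R setT = 1%E.
Proof.
rewrite /lebesgue01 /mrestr setTI lebesgue_measure_itv /= lte_fin ltr01.
by rewrite -EFinB subr0.
Qed.

Lemma lebesgue01_integrable_bounded (R : realType) (g : measurableTypeR R -> R)
    (B : R) :
  measurable_fun setT g -> (forall t, `|g t| <= B) ->
  (@lebesgue01 R).-integrable setT (EFin \o g).
Proof.
move=> mg gB; apply: measurable_bounded_integrable => //.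
  by rewrite [X in (X < _)%E](lebesgue01_setT R) ltry.
exists B; split; first exact: num_real.
by move=> M BM t _ /=; rewrite (le_trans (gB t))// ltW.
Qed.

Section realization.
Context (R : realType) (X : Type) (n : nat).
Variables (E : (X -> R) -> R) (mE : is_mean E).
Variables (f : 'I_n -> X -> R) (B : R).
Hypothesis f_le : forall i x, `|f i x| <= B.

Let mu := @lebesgue01 R.

(** Comparing the coordinates with all rationals: the first answers determine
    the coordinates up to an error that becomes arbitrarily small. *)
Let bit (d : nat) (x : X) : bool :=
  if @choice.unpickle [the countType of ('I_n * rat)%type] d is Some ir
  then f ir.1 x <= ratr ir.2 else false.

Fixpoint code d x : nat :=
  if d is d'.+1 then (code d' x).*2 + bit d' x else 0%N.

Let code_lt d x : (code d x < 2 ^ d)%N.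
Proof.
elim: d => // d IH /=; rewrite expnS mul2n -!addnn.
by case: (bit d x); lia.
Qed.

Let code_half k d x : code d x = (code (k + d) x %/ 2 ^ k)%N.
Proof.
elim: k => [|k IH]; first by rewrite divn1.
rewrite IH addSn /= expnS divnMA divn2; congr (_ %/ _)%N.
case: (bit _ _); rewrite ?addn0 ?doubleK//.
by rewrite addn1 -[_.+1./2]/(uphalf _) uphalf_double.
Qed.

Let code_bit d k x y : (k < d)%N -> code d x = code d y -> bit k x = bit k y.
Proof.
move=> kd cxy; have h z : code k.+1 z = (code d z %/ 2 ^ (d - k.+1))%N.
  by have := code_half (d - k.+1) k.+1 z; rewrite subnK.
have : code k.+1 x = code k.+1 y by rewrite !h cxy.
move=> /(congr1 odd) /=; rewrite !oddD !odd_double /= !oddb.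
by [].
Qed.

Let code_separates e : 0 < e -> exists D, forall x y,
  code D x = code D y -> forall i, `|f i x - f i y| <= e.
Proof.
move=> e0.
have e0' : 0 <= e^-1 by rewrite invr_ge0 ltW.
(* The rationals [q k] form a grid of mesh [1 / m < e] covering [-B, B], so
   one of them separates any two values more than [e] apart. *)
pose m := (Num.bound e^-1).+1.
have m0 : 0 < m%:R :> R by rewrite ltr0n.
have me : m%:R^-1 < e.
  rewrite -[e]invrK ltf_pV2 ?posrE ?invr_gt0//.
  by rewrite (lt_le_trans (archi_boundP e0'))// ler_nat /m.
pose K := (Num.bound (`|B| * m%:R)).+1.
have KB : `|B| * m%:R < K%:R.
  by rewrite (lt_trans (archi_boundP _))// ?mulr_ge0// ltr_nat /K.
pose q (k : nat) : rat := (k%:Z - K%:Z)%:Q / m%:Q.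
pose D := (\max_i \max_(k < 2 * K + 2)
  (@choice.pickle [the countType of ('I_n * rat)%type] (i, q k))).+1.
exists D => x y cxy i.
wlog fxy : x y cxy / f i x <= f i y.
  move=> h; case/orP: (le_total (f i x) (f i y)) => [|/(h _ _ (esym cxy))].
    exact: h.
  by rewrite distrC.
rewrite ler0_norm ?subr_le0// opprB leNgt; apply/negP => lt_e.
have qE k : ratr (q k) = (k%:R - K%:R) / m%:R :> R.
  by rewrite /q fmorph_div /= !ratr_int intrB.
have fb x' : 0 <= f i x' * m%:R + K%:R /\ f i x' * m%:R + K%:R < 2 * K%:R.
  have := f_le i x'; rewrite ler_norml => /andP[h1 h2].
  have h3 := ler_norm B; have : - `|B| * m%:R <= f i x' * m%:R <= `|B| * m%:R.
    by rewrite !ler_pM2r//; apply/andP; split; lra.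
  by move=> /andP[]; lra.
have [fx0 fxK] := fb x.
pose k := (Num.truncn (f i x * m%:R + K%:R)).+1.
have /andP[tk1 tk2] := truncn_itv fx0.
have kK : (k < 2 * K + 2)%N.
  rewrite /k; have : (Num.truncn (f i x * m%:R + K%:R) < 2 * K)%N.
    by rewrite -(ltr_nat R) natrM (le_lt_trans tk1).
  lia.
have xq : f i x <= ratr (q k).
  rewrite qE ler_pdivlMr// lerBrDr; exact: ltW.
have yq : ratr (q k) < f i y.
  apply: le_lt_trans (_ : f i x + m%:R^-1 < _); last by lra.
  rewrite qE ler_pdivrMr// mulrDl mulVf ?gt_eqF//.
  by move: tk1; rewrite /k -natr1; lra.
have kD : (@choice.pickle [the countType of ('I_n * rat)%type] (i, q k) < D)%N.
  rewrite /D ltnS; apply: leq_trans (leq_bigmax i).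
  exact: (leq_bigmax (Ordinal kK)).
have := code_bit kD cxy; rewrite /bit choice.pickleK /= xq.
by rewrite leNgt yq.
Qed.

(** The cells of level [d] cut [0, 1) into consecutive intervals whose lengths
    are the masses of the codes. *)
Let A d v : R := E (fun x => (code d x < v)%N%:R).

Let bb (b : X -> bool) : bounded_real (fun x => (b x)%:R : R) :=
  bounded_real_bool R b.

Let A_ge0 d v : 0 <= A d v.
Proof. exact: (mean_ge0 mE (bb _)). Qed.

Let A0 d : A d 0 = 0.
Proof. by rewrite /A (_ : (fun x => _) = fun=> 0) ?mean0//; apply/funext. Qed.

Let A_top d : A d (2 ^ d)%N = 1.
Proof.
rewrite /A (_ : (fun x => _) = fun=> 1) ?(mean1 mE)//.
by apply/funext => x; rewrite code_lt.
Qed.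

Let A_mono d v v' : (v <= v')%N -> A d v <= A d v'.
Proof.
move=> vv'; apply: (le_mean mE (bb _) (bb _)) => x.
by rewrite ler_nat; case: ltnP => // xv; rewrite (leq_trans xv).
Qed.

Let A_le1 d v : A d v <= 1.
Proof.
rewrite -(mean1 mE); apply: (le_mean mE (bb _) (bounded_real_cst X 1)) => x.
by case: (_ < _)%N.
Qed.

Let A_refine k d v : A (k + d) (v * 2 ^ k)%N = A d v.
Proof.
congr E; apply/funext => x; congr (_%:R); congr nat_of_bool.
by rewrite (code_half k d) ltn_divLR// expn_gt0.
Qed.

Let mass d v : E (fun x => (code d x == v)%:R) = A d v.+1 - A d v.
Proof.
rewrite -(meanB mE (bb _) (bb _)); congr E; apply/funext => x.
rewrite ltnS leq_eqVlt; case: eqP => [->|_] /=; first by rewrite ltnn subr0.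
by rewrite subrr.
Qed.

Let cell d v : set (measurableTypeR R) := `[A d v, A d v.+1[%classic.

Let cellP d v t : cell d v t <-> A d v <= t < A d v.+1.
Proof. by rewrite /cell /= in_itv. Qed.

Let cell_uniq d v v' t : cell d v t -> cell d v' t -> v = v'.
Proof.
move=> /cellP/andP[h1 h2] /cellP/andP[h3 h4].
have aux u u' : A d u <= t -> t < A d u'.+1 -> (u <= u')%N.
  move=> ut tu'; rewrite leqNgt; apply/negP => /(A_mono d).
  by rewrite leNgt (le_lt_trans ut tu').
by apply/eqP; rewrite eqn_leq !aux.
Qed.

Let cell_ex d t : 0 <= t < 1 -> exists2 v, (v < 2 ^ d)%N & cell d v t.
Proof.
move=> /andP[t0 t1]; have ex : exists v, t < A d v by exists (2 ^ d)%N; rewrite A_top.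
case: (ex_minnP ex) => -[|v] tv vmin; first by rewrite A0 ltNge t0 in tv.
exists v; first by apply: vmin; rewrite A_top.
apply/cellP; rewrite tv andbT leNgt; apply/negP => /vmin.
by rewrite ltnn.
Qed.

Let cell_refine k d v t : cell (k + d) v t -> cell d (v %/ 2 ^ k) t.
Proof.
move=> /cellP/andP[h1 h2]; apply/cellP; have k0 : (0 < 2 ^ k)%N by rewrite expn_gt0.
rewrite -(A_refine k) (le_trans (A_mono _ _) h1) ?leq_trunc_div//=.
by rewrite -(A_refine k) (lt_le_trans h2)// A_mono// ltn_ceil.
Qed.

(** A cell containing a point has positive length, so its code has positive
    mass and is taken. *)
Let nonempty_cell d v t : cell d v t -> exists x, code d x = v.
Proof.
move=> /cellP/andP[h1 h2]; apply: contrapT => /forallNP noc.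
have := mass d v; rewrite (_ : (fun x => _) = fun=> 0) ?mean0//.
  by move=> /esym/eqP; rewrite subr_eq0 gt_eqF// (le_lt_trans h1).
by apply/funext => x; case: eqP => // /noc.
Qed.

Let corner d v i : R :=
  if pselect (exists x, code d x = v) is left ex then f i (projT1 (cid ex))
  else 0.

Let cornerE d v : (exists x, code d x = v) ->
  exists2 x, code d x = v & forall i, corner d v i = f i x.
Proof.
rewrite /corner; case: pselect => // ex _.
by exists (projT1 (cid ex)) => //; exact: (projT2 (cid ex)).
Qed.

Let step d i (t : measurableTypeR R) : R :=
  \sum_(v < 2 ^ d) corner d v i * \1_(cell d v) t.

Let step_cell d v t (G : nat -> R) : (v < 2 ^ d)%N -> cell d v t ->
  \sum_(u < 2 ^ d) G u * \1_(cell d u) t = G v.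
Proof.
move=> vd vt; rewrite (bigD1 (Ordinal vd))//= indicE mem_set// mulr1.
rewrite big1 ?addr0// => u uv; rewrite indicE memNset ?mulr0// => ut.
by move/eqP: uv; apply; apply/val_inj; exact: (cell_uniq ut vt).
Qed.

Let step_out d t (G : nat -> R) : ~~ (0 <= t < 1) ->
  \sum_(u < 2 ^ d) G u * \1_(cell d u) t = 0.
Proof.
move=> tn; apply: big1 => u _; rewrite indicE memNset ?mulr0//.
move=> /cellP/andP[h1 h2]; move: tn; rewrite (le_trans _ h1)//=.
by rewrite (lt_le_trans h2).
Qed.

Let step_value d t : 0 <= t < 1 ->
  exists2 x, (forall i, step d i t = f i x) & cell d (code d x) t.
Proof.
move=> t01; have [v vd vt] := cell_ex d t01.
have [x cx fx] := cornerE (nonempty_cell vt).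
exists x => [i|]; last by rewrite cx.
by rewrite /step (step_cell (fun u => corner d u i) vd vt) fx.
Qed.

Let step_close e : 0 < e ->
  exists D, forall d d' i t, (D <= d)%N -> (d <= d')%N ->
  `|step d i t - step d' i t| <= e.
Proof.
move=> e0; have [D hD] := code_separates e0; exists D => d d' i t Dd dd'.
have [t01|t01] := boolP (0 <= t < 1); last first.
  rewrite /step (step_out d (corner d ^~ i) t01).
  by rewrite (step_out d' (corner d' ^~ i) t01) subrr normr0 ltW.
have [x -> cx] := step_value d t01; have [y -> cy] := step_value d' t01.
have cD k (z : X) : (D <= k)%N -> cell k (code k z) t -> cell D (code D z) t.
  move=> Dk; rewrite -{1 2}(subnK Dk) => /cell_refine.
  by rewrite -code_half.
apply: hD; apply: cell_uniq (cD _ _ Dd cx) (cD _ _ (leq_trans Dd dd') cy).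
Qed.

Let step_bounded d i t : `|step d i t| <= `|B|.
Proof.
have [t01|t01] := boolP (0 <= t < 1); last first.
  by rewrite /step (step_out d (corner d ^~ i) t01) normr0.
by have [x -> _] := step_value d t01; rewrite (le_trans (f_le _ _))// ler_norm.
Qed.

Let measurable_step d i : measurable_fun setT (step d i).
Proof.
apply: measurable_sum => v; apply: measurable_funM; first exact: measurable_cst.
apply: measurable_indic; exact: measurable_itv.
Qed.

Let cvg_step i t : cvg (step d i t @[d --> \oo]).
Proof.
apply: R_complete; apply: cauchy_exP => e e0.
have e2 : 0 < e / 2 by rewrite divr_gt0.
have [D hD] := step_close e2; exists (step D i t).
exists D => // d /= Dd; rewrite -ball_normE /=.
by rewrite (le_lt_trans (hD D d i t (leqnn _) Dd))//; lra.
Qed.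

Let g i (t : measurableTypeR R) : R := limn (fun d => step d i t).

Let step_g e : 0 < e ->
  exists D, forall d i t, (D <= d)%N -> `|step d i t - g i t| <= e.
Proof.
move=> e0; have [D hD] := step_close e0; exists D => d i t Dd.
have : `|step d i t - step d' i t| @[d' --> \oo] --> `|step d i t - g i t|.
  by apply: cvg_norm; apply: cvgB; [exact: cvg_cst|exact: cvg_step].
move=> /cvgr_to_le; apply; near=> d'; apply: hD => //.
by near: d'; exact: nbhs_infty_ge.
Unshelve. all: by end_near. Qed.

Let measurable_g i : measurable_fun setT (g i).
Proof.
apply: (measurable_fun_cvg (h := step ^~ i)) => [d|t _].
  exact: measurable_step.
exact: cvg_step.
Qed.

Let g_bounded i t : `|g i t| <= `|B|.
Proof.
have : `|step d i t| @[d --> \oo] --> `|g i t|.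
  by apply: cvg_norm; exact: cvg_step.
move=> /cvgr_to_le; apply.
by apply: filterE => d; exact: step_bounded.
Qed.

Let integral_step d (G : nat -> R) :
  \int[mu]_t (\sum_(v < 2 ^ d) G v * \1_(cell d v) t) =
    E (fun x => G (code d x)).
Proof.
have mcell v : measurable (cell d v) by exact: measurable_itv.
have Icell v : mu.-integrable setT (EFin \o \1_(cell d v)).
  apply: (@lebesgue01_integrable_bounded _ _ 1); first exact: measurable_indic.
  by move=> t; rewrite indicE; case: (_ \in _); rewrite ?normr1 ?normr0.
rewrite Rintegral_sum; last by move=> v; exact: rintegrableZ.
have -> : (fun x => G (code d x)) =
    fun x => \sum_(v < 2 ^ d) G v * (code d x == v)%:R.
  apply/funext => x; rewrite (bigD1 (Ordinal (code_lt d x)))//= eqxx mulr1.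
  rewrite big1 ?addr0// => v /negPf vx.
  rewrite -[code d x]/(nat_of_ord (Ordinal (code_lt d x))) eq_sym.
  by rewrite (inj_eq val_inj) vx mulr0.
rewrite mean_sum//; last by move=> v; apply: bounded_realZ; exact: bb.
apply: eq_bigr => v _; rewrite (meanZ mE _ (bb (fun x => code d x == v))).
rewrite RintegralZl//; congr (_ * _).
rewrite mass /Rintegral /= (integral_indic mu)// setIT.
by rewrite [X in fine X](lebesgue01_itv (A_ge0 d v) (A_mono d (leqnSn v)) (A_le1 d v.+1)).
Qed.

(** At level [d] the integral of the step functions is a mean of values at
    representatives of the cells; both sides converge as the cells shrink. *)
Lemma mean_realization : exists h : 'I_n -> measurableTypeR R -> R,
  [/\ forall i, measurable_fun setT (h i), forall i t, `|h i t| <= `|B| &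
    forall c : 'I_n -> R, \int[mu]_t `|\sum_i c i * h i t| =
      E (fun x => `|\sum_i c i * f i x|)].
Proof.
exists g; split => // c.
pose s := \sum_i `|c i|.
have s0 : 0 <= s by exact: sumr_ge0.
have dist (u u' : 'I_n -> R) e : (forall i, `|u i - u' i| <= e) ->
    `| `|\sum_i c i * u i| - `|\sum_i c i * u' i| | <= s * e.
  move=> uu; rewrite (le_trans (ler_dist_dist _ _))// -sumrB.
  rewrite (le_trans (ler_norm_sum _ _ _))// mulr_suml; apply: ler_sum => i _.
  by rewrite -mulrBr normrM ler_wpM2l.
have bf : bounded_real (fun x => `|\sum_i c i * f i x|).
  apply/bounded_real_norm/bounded_real_sum => i; apply: bounded_realZ.
  by exists B => x; exact: f_le.
have bcorner d : bounded_real (fun x => `|\sum_i c i * corner d (code d x) i|).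
  apply/bounded_real_norm/bounded_real_sum => i; apply: bounded_realZ.
  exists B => x.
  have [y _ ->] := cornerE (ex_intro (fun y => code d y = code d x) x erefl).
  exact: f_le.
have integrable_comb (h : 'I_n -> measurableTypeR R -> R) :
    (forall i, measurable_fun setT (h i)) -> (forall i t, `|h i t| <= `|B|) ->
    mu.-integrable setT (EFin \o (fun t => `|\sum_i c i * h i t|)).
  move=> mh hB; apply: rintegrable_norm; apply: rintegrable_sum => i _.
  by apply: rintegrableZ; exact: lebesgue01_integrable_bounded (mh i) (hB i).
apply/eqP; rewrite -subr_eq0 -normr_le0; apply/ler_addgt0Pr => e e0.
rewrite add0r; pose e' := e / (2 * (s + 1)).
have e'0 : 0 < e' by rewrite divr_gt0// mulr_gt0// ltr_wpDl.
have [D1 hD1] := code_separates e'0.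
have [D2 hD2] := step_g e'0.
pose d := maxn D1 D2.
have se : s * e' <= e / 2.
  have -> : e / 2 = (s + 1) * e' by rewrite /e'; field; rewrite gt_eqF// ltr_wpDl.
  by rewrite ler_wpM2r ?(ltW e'0)// lerDl.
have h1 : `|\int[mu]_t `|\sum_i c i * g i t| -
    \int[mu]_t `|\sum_i c i * step d i t| | <= s * e'.
  rewrite -RintegralB//; [|exact: integrable_comb..].
  have Idiff := rintegrableB (integrable_comb _ measurable_g g_bounded)
    (integrable_comb _ (measurable_step d) (step_bounded d)).
  rewrite (le_trans (le_normr_Rintegral _ Idiff))//.
  have -> : s * e' = \int[mu]_t (s * e').
    by rewrite Rintegral_cst// [X in fine X](lebesgue01_setT R) mulr1.
  apply: le_Rintegral => //; first exact: rintegrable_norm.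
    apply: (@lebesgue01_integrable_bounded _ _ `|s * e'|); first exact: measurable_cst.
    by move=> t; rewrite lexx.
  by move=> t _; apply: dist => i; rewrite distrC hD2// leq_maxr.
have h2 : \int[mu]_t `|\sum_i c i * step d i t| =
    E (fun x => `|\sum_i c i * corner d (code d x) i|).
  rewrite -(integral_step d (fun v => `|\sum_i c i * corner d v i|)).
  apply: eq_Rintegral => t _.
  have [t01|t01] := boolP (0 <= t < 1); last first.
    rewrite (step_out d (fun v => `|\sum_i c i * corner d v i|) t01).
    rewrite big1 ?normr0// => i _.
    by rewrite /step (step_out d (corner d ^~ i) t01) mulr0.
  have [v vd vt] := cell_ex d t01.
  rewrite (step_cell (fun v => `|\sum_i c i * corner d v i|) vd vt).
  congr (`| _ |); apply: eq_bigr => i _.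
  by rewrite /step (step_cell (corner d ^~ i) vd vt).
have h3 : `|E (fun x => `|\sum_i c i * corner d (code d x) i|) -
    E (fun x => `|\sum_i c i * f i x|)| <= s * e'.
  apply: mean_dist_le => // x; apply: dist => i.
  have [y cy ->] := cornerE (ex_intro (fun y => code d y = code d x) x erefl).
  apply: hD1; rewrite !(code_half (d - D1) D1) subnK ?leq_maxl//.
  by rewrite cy.
apply: (le_trans (ler_distD (\int[mu]_t `|\sum_i c i * step d i t|) _ _)).
rewrite [leRHS](_ : e = e / 2 + e / 2); last by field.
by apply: lerD; [exact: le_trans se|rewrite h2; exact: le_trans se].
Qed.
End realization.

(** * Negative type gives a linear embedding *)

(** A seminorm varies by a bounded amount over the unit cube, so comparing at
    the integer part of [m x] and dividing by [m] gives equality at [x]. *)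
Lemma seminorm_eq_integer (R : realType) n (N N' : 'rV[R]_n -> R) :
  (forall a x, N (a *: x) = `|a| * N x) ->
  (forall x y, N (x + y) <= N x + N y) ->
  (forall a x, N' (a *: x) = `|a| * N' x) ->
  (forall x y, N' (x + y) <= N' x + N' y) ->
  (forall z : 'rV[int]_n, N (z2r R z) = N' (z2r R z)) -> N =1 N'.
Proof.
move=> NZ ND N'Z N'D NN' x.
have lip (P : 'rV[R]_n -> R) : (forall a x, P (a *: x) = `|a| * P x) ->
    (forall x y, P (x + y) <= P x + P y) -> forall u u' : 'rV[R]_n,
    (forall i, `|u 0 i - u' 0 i| <= 1) ->
    `|P u - P u'| <= \sum_i P (delta_mx 0 i).
  move=> PZ PD; suff half (u u' : 'rV[R]_n) : (forall i, `|u 0 i - u' 0 i| <= 1) ->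
      P u - P u' <= \sum_i P (delta_mx 0 i).
    move=> u u' uu'; rewrite ler_norml; apply/andP; split; last exact: half.
    by rewrite lerNl opprB half// => i; rewrite distrC.
  move=> uu'; rewrite lerBlDr -{1}(subrK u' u) (le_trans (PD _ _))// lerD2r.
  rewrite -[leRHS]mul1r; apply: (seminorm_le_coord PZ PD) => i.
  by rewrite !mxE; exact: uu'.
set c := \sum_i N (delta_mx 0 i); set c' := \sum_i N' (delta_mx 0 i).
apply/eqP; rewrite -subr_eq0 -normr_le0 leNgt; apply/negP => d0.
have cc0 : 0 <= c + c'.
  by rewrite addr_ge0//; apply: sumr_ge0 => i _; exact: seminorm_ge0.
have q0 : 0 <= (c + c') / `|N x - N' x| by rewrite divr_ge0// ltW.
have := archi_boundP q0; set m := Num.bound _; rewrite ltr_pdivrMr//.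
apply/negP; rewrite -leNgt.
pose z : 'rV[int]_n := \row_i Num.floor (m%:R * x 0 i).
have mz i : `|(m%:R *: x) 0 i - (z2r R z) 0 i| <= 1.
  rewrite !mxE; have := floor_le (m%:R * x 0 i).
  have := floorD1_gt (m%:R * x 0 i); rewrite intrD.
  rewrite ler_norml => h1 h2; apply/andP; split; lra.
have -> : m%:R * `|N x - N' x| = `|N (m%:R *: x) - N' (m%:R *: x)|.
  by rewrite NZ N'Z normr_nat -mulrBr normrM normr_nat.
rewrite (le_trans (ler_distD (N (z2r R z)) _ _))// lerD ?lip//.
by rewrite NN' distrC lip.
Qed.

(** Every seminorm of negative type on $\mathbb{R}^n$ is the average of
    [|<x, h t>|] over [t] in [0, 1]: take the mean of the approximating
    spectral measures and realize it. *)
Lemma seminorm_integral (R : realType) n (N : 'rV[R]_n -> R) :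
  (forall a x, N (a *: x) = `|a| * N x) ->
  (forall x y, N (x + y) <= N x + N y) ->
  psd_kernel (fun x y => expR (- N (x - y))) ->
  exists h : 'I_n -> measurableTypeR R -> R,
    (forall i, (@lebesgue01 R).-integrable setT (EFin \o h i)) /\
    forall x : 'rV[R]_n, N x = \int[@lebesgue01 R]_t `|\sum_i x 0 i * h i t|.
Proof.
move=> NZ ND psdN.
have [B [C approx]] := spectral_approximation NZ ND psdN.
pose pack := {J : finType & ((J -> R) * (J -> 'rV[R]_n))%type}.
have /choice[P HP] : forall a, exists P : pack,
  [/\ forall j, 0 <= (tagged P).1 j, \sum_j (tagged P).1 j = 1,
      forall j i, `|(tagged P).2 j 0 i| <= B &
      forall z : 'rV[int]_n, (forall i, `|z 0 i| <= (2 ^ a)%N%:Z) ->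
        `|N (z2r R z) - \sum_j (tagged P).1 j * `|dotz z ((tagged P).2 j)| | <=
           C z / a.+1%:R].
  move=> a; have [J [w [xi h]]] := approx a.
  by exists (existT _ J (w, xi)).
pose X := {x : 'rV[R]_n | forall i, `|x 0 i| <= B}.
pose J a := tag (P a).
pose w a (j : J a) := (tagged (P a)).1 j.
pose x a (j : J a) : X := exist _ ((tagged (P a)).2 j)
  (let: And4 _ _ h _ := HP a in h j).
have w0 a j : 0 <= w a j by have [+ _ _ _] := HP a; exact.
have w1 a : \sum_j w a j = 1 by have [] := HP a.
have [E mE limE] := ultra_mean x w0 w1.
pose f i (y : X) := sval y 0 i.
have f_le i y : `|f i y| <= B by case: y => y yB; exact: yB.
have [h [mh hB hE]] := mean_realization mE f_le.
have Ih i : (@lebesgue01 R).-integrable setT (EFin \o h i).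
  exact: lebesgue01_integrable_bounded (mh i) (hB i).
exists h; split => //.
pose N' (y : 'rV[R]_n) := \int[@lebesgue01 R]_t `|\sum_i y 0 i * h i t|.
have Icomb (y : 'rV[R]_n) :
    (@lebesgue01 R).-integrable setT (EFin \o (fun t => \sum_i y 0 i * h i t)).
  by apply: rintegrable_sum => i _; exact: rintegrableZ.
apply: (@seminorm_eq_integer _ _ N N') => //.
- move=> a y; rewrite /N' -RintegralZl//; last exact: rintegrable_norm.
  apply: eq_Rintegral => t _; rewrite -normrM mulr_sumr; congr (`|_|).
  by apply: eq_bigr => i _; rewrite mxE mulrA.
- move=> y y'; rewrite /N' -RintegralD//; [|exact: rintegrable_norm..].
  apply: le_Rintegral => //; first exact: rintegrable_norm.
    by apply: rintegrableD; exact: rintegrable_norm.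
  move=> t _; rewrite -[X in `|X| <= _](_ : \sum_i y 0 i * h i t +
      \sum_i y' 0 i * h i t = _) ?ler_normD//.
  by rewrite -big_split /=; apply: eq_bigr => i _; rewrite mxE mulrDl.
move=> z; apply/esym; rewrite /N' hE.
have bz : bounded_real (fun y : X => `|\sum_i (z2r R z) 0 i * f i y|).
  apply/bounded_real_norm/bounded_real_sum => i; apply: bounded_realZ.
  by exists B => y.
apply: limE => //; apply/cvgrPdist_le => e e0; near=> a.
have zE : \sum_j w a j * `|\sum_i (z2r R z) 0 i * f i (x a j)| =
    \sum_j w a j * `|dotz z ((tagged (P a)).2 j)|.
  by apply: eq_bigr => j _; congr (_ * `|_|); apply: eq_bigr => i _; rewrite mxE.
rewrite zE; have [_ _ _ hz] := HP a; apply: (le_trans (hz z _)).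
  move=> i; apply: (@le_trans _ _ (\sum_k `|z 0 k|)).
    by rewrite (bigD1 i)//= lerDl sumr_ge0.
  have -> : \sum_k `|z 0 k| = (\sum_k absz (z 0%R k))%N%:Z.
    by rewrite -natz natr_sum; apply: eq_bigr => k _; rewrite natz abszE.
  rewrite lez_nat (leq_trans _ (ltnW (ltn_expl a (ltnSn 1))))//.
  by near: a; exact: nbhs_infty_ge.
rewrite ler_pdivrMr ?ltr0n// mulrC -ler_pdivrMr//.
rewrite (@le_trans _ _ a%:R) ?ler_nat//; near: a; exact: nbhs_infty_ger.
Unshelve. all: by end_near. Qed.

Section linear_embedding.
Context (R : realType) (V : normedModType R).

Lemma comp_psd_kernel (S T : Type) (K : T -> T -> R) (h : S -> T) :
  psd_kernel K -> psd_kernel (fun x y => K (h x) (h y)).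
Proof. by move=> hK I x v; exact: (hK I (h \o x) v). Qed.

(** A vector is sent to the combination of the functions [h i] given by some
    choice of its coefficients. Two choices give the same class: the L1 norm of
    the difference is the norm of the corresponding combination in [V], which
    is 0. *)
Lemma negative_type_embeds :
  finite_dimensional [set: V] ->
  psd_kernel (fun x y : V => expR (- `|x - y|)) ->
  exists phi : {linear V -> L1 R}, forall x, `|phi x| = `|x|.
Proof.
move=> [n [b [_ span]]] psdV.
pose comb (c : 'rV[R]_n) := \sum_i c 0 i *: b i.
have combD c c' : comb (c + c') = comb c + comb c'.
  by rewrite -big_split /=; apply: eq_bigr => i _; rewrite mxE scalerDl.
have combZ a c : comb (a *: c) = a *: comb c.
  by rewrite scaler_sumr; apply: eq_bigr => i _; rewrite mxE scalerA.
have combB c c' : comb (c - c') = comb c - comb c'.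
  by rewrite combD; congr (_ + _); rewrite -[- c']scaleN1r combZ scaleN1r.
have [h [Ih hN]] : exists h : 'I_n -> measurableTypeR R -> R,
    (forall i, (@lebesgue01 R).-integrable setT (EFin \o h i)) /\
    forall c : 'rV[R]_n, `|comb c| = \int[@lebesgue01 R]_t `|\sum_i c 0 i * h i t|.
  apply: seminorm_integral.
  - by move=> a c; rewrite combZ normrZ.
  - by move=> c c'; rewrite combD ler_normD.
  - have := comp_psd_kernel comb psdV.
    by apply: eq_psd_kernel => c c'; rewrite combB.
have hL i : h i \in Lfun (@lebesgue01 R) 1 by apply/Lfun1_integrable.
pose g i : L1 R := L1class (Lfun_Sub (@lexx _ _ 1%E) (hL i)).
have gN (c : 'rV[R]_n) : `|\sum_i c 0 i *: g i| = `|comb c|.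
  rewrite hN; apply: L1norm_ae.
    by apply: rintegrable_sum => i _; exact: rintegrableZ.
  have gh : \forall t \ae @lebesgue01 R, forall i, L1fun (g i) t = h i t.
    apply: filter_forall => i; have := L1class_ae (Lfun_Sub (@lexx _ _ 1%E) (hL i)).
    by apply: filterS => t /(_ I).
  apply: filterS2 gh (L1fun_sumZ (index_enum 'I_n) (fun i => c 0 i) g) => t h1 h2 Dt.
  by rewrite h2//; apply: eq_bigr => i _; rewrite h1.
have /choice[coef coefE] : forall x : V, exists c : 'rV[R]_n, x = comb c.
  move=> x; have [c ->] := span x I; exists (\row_i c i).
  by apply: eq_bigr => i _; rewrite mxE.
pose phi x := \sum_i coef x 0 i *: g i.
have lin : linear phi.
  move=> a x y; apply/eqP; rewrite -subr_eq0 -normr_eq0.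
  have -> : phi (a *: x + y) - (a *: phi x + phi y) =
      \sum_i (coef (a *: x + y) - (a *: coef x + coef y)) 0 i *: g i.
    rewrite /phi scaler_sumr -big_split /= -sumrB; apply: eq_bigr => i _.
    by rewrite !mxE scalerBl scalerDl scalerA.
  by rewrite gN combB combD combZ -!coefE subrr normr0.
pose L : {linear V -> L1 R} :=
  HB.pack phi (GRing.isLinear.Build R V (L1 R) _ phi lin).
by exists L => x; rewrite /= /phi gN -coefE.
Qed.

End linear_embedding.

(** * Finite dimension and compactness of balls *)

Section finite_dimension.
Context (R : realType) (V : normedModType R).

Lemma mdist_norm (x y : normed_metric V) : mdist x y = `|(x : V) - y|.
Proof. by []. Qed.

Let span n (b : 'I_n -> V) (c : 'I_n -> R) : V := \sum_i c i *: b i.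

Lemma ultra_comb_cvg (S : Type) (U : set_system S) n (b : 'I_n -> V)
    (c : 'I_n -> S -> R) (K : R) :
  UltraFilter U -> (forall i, \forall t \near U, `|c i t| <= K) ->
  exists l : 'I_n -> R, span b (c ^~ t) @[t --> U] --> span b l.
Proof.
move=> ultU cK; exists (fun i => lim (c i @ U)).
apply: (@cvg_big _ _ +%R 0) => [x|i _]; first exact: add_continuous.
by apply: cvgZr_tmp; exact: bounded_cvg_ultra (cK i).
Qed.

Definition coef_bound n (b : 'I_n -> V) (K : R) := forall c, exists2 c',
  span b c = span b c' & forall i, `|c' i| <= K * `|span b c|.

(** Approximating vectors have bounded coefficients, so these converge along an
    ultrafilter. *)
Lemma span_closed n (b : 'I_n -> V) (K : R) (x : V) : 0 <= K -> coef_bound b K ->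
  (forall e, 0 < e -> exists c, `|x - span b c| < e) -> exists c, x = span b c.
Proof.
move=> K0 bK near_x.
have near_k (k : nat) : exists c, `|x - span b c| < k.+1%:R^-1 /\
    forall i, `|c i| <= K * (`|x| + 1).
  have [c xc] := near_x k.+1%:R^-1 ltac:(by rewrite invr_gt0).
  have [c' cc' c'K] := bK c; exists c'; rewrite -cc'; split=> // i.
  rewrite (le_trans (c'K i))// ler_wpM2l// -lerBlDl.
  have k1 : k.+1%:R^-1 <= 1 :> R by rewrite invf_le1// ler1n.
  by rewrite (le_trans (lerB_dist _ _))// distrC (le_trans (ltW xc)).
have /choice[c Hc] := near_k.
have [U [ultU ooU]] := @ultraFilterLemma nat \oo _.
have [|l cl] := @ultra_comb_cvg _ U n b (fun i k => c k i) (K * (`|x| + 1)) ultU.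
  by move=> i; apply: filterE => k; have [_ +] := Hc k; exact.
have cx : span b (c k) @[k --> \oo] --> x.
  apply/cvgrPdist_lt => e e0; near=> k.
  have [xk _] := Hc k; apply: (lt_trans xk).
  by near: k; exact: (near_infty_natSinv_lt (PosNum e0)).
have Ux : span b (c k) @[k --> U] --> x by apply: cvg_trans cx; exact: cvg_app.
by exists l; exact: (cvg_unique (@norm_hausdorff R V) Ux cl).
Unshelve. all: by end_near. Qed.

(** If [b ord0] is outside the span of the other vectors, it is at positive
    distance from that span because the span is closed; this distance bounds
    its coefficient. *)
Lemma coef_bound_exists n (b : 'I_n -> V) : exists2 K, 0 <= K & coef_bound b K.
Proof.
elim: n b => [|n IH] b.
  by exists 0 => // c; exists c => // -[].
pose b' i := b (lift ord0 i); pose v := b ord0.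
have [K' K'0 bK'] := IH b'.
have spanS c : span b c = c ord0 *: v + span b' (fun i => c (lift ord0 i)).
  by rewrite /span big_ord_recl.
pose ext (c0 : R) (c : 'I_n -> R) (i : 'I_n.+1) : R :=
  if unlift ord0 i is Some j then c j else c0.
have extE c0 c : span b (ext c0 c) = c0 *: v + span b' c.
  rewrite spanS /ext unlift_none; congr (_ + _); apply: eq_bigr => i _.
  by rewrite liftK.
have [[d vd]|nv] := pselect (exists d, v = span b' d).
  exists K' => // c; have [c' cc' c'K] := bK' (fun i => c ord0 * d i + c (lift ord0 i)).
  have xE : span b c = span b' (fun i => c ord0 * d i + c (lift ord0 i)).
    rewrite spanS vd /span scaler_sumr -big_split; apply: eq_bigr => i _.
    by rewrite scalerDl scalerA.
  exists (ext 0 c') => [|i]; first by rewrite extE scale0r add0r xE.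
  rewrite /ext; case: unliftP => [j _|_]; first by rewrite xE c'K.
  by rewrite normr0 mulr_ge0.
have [e e0 dist_v] : exists2 e, 0 < e & forall d, e <= `|v - span b' d|.
  apply: contrapT => nd; apply: nv; apply: (span_closed K'0 bK') => e e0.
  apply: contrapT => nc; apply: nd; exists e => // d.
  by rewrite leNgt; apply/negP => de; apply: nc; exists d.
exists (e^-1 + K' * (1 + `|v| / e)).
  by rewrite addr_ge0 ?mulr_ge0 ?addr_ge0 ?divr_ge0 ?invr_ge0 ?(ltW e0).
move=> c; set x := span b c.
pose w := span b' (fun i => c (lift ord0 i)).
have xE : x = c ord0 *: v + w := spanS c.
have c0x : `|c ord0| <= `|x| / e.
  rewrite ler_pdivlMr//; have [->|c00] := eqVneq (c ord0) 0.
    by rewrite normr0 mul0r.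
  have -> : x = c ord0 *: (v - span b' (fun i => - ((c ord0)^-1 * c (lift ord0 i)))).
    rewrite xE scalerBr; congr (_ + _); rewrite /w /span scaler_sumr -sumrN.
    by apply: eq_bigr => i _; rewrite scalerA mulrN mulVKf// scaleNr opprK.
  by rewrite normrZ ler_wpM2l.
have wx : `|w| <= (1 + `|v| / e) * `|x|.
  have -> : w = x - c ord0 *: v by rewrite xE addrAC subrr add0r.
  rewrite (le_trans (ler_normB _ _))// mulrDl mul1r lerD2l normrZ.
  have -> : `|v| / e * `|x| = `|x| / e * `|v| by ring.
  by rewrite ler_wpM2r.
have [c' cc' c'K] := bK' (fun i => c (lift ord0 i)).
exists (ext (c ord0) c') => [|i]; first by rewrite extE -cc' -xE.
rewrite mulrDl /ext; case: unliftP => [j _|_].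
  rewrite (le_trans (c'K j))// -[leLHS]add0r lerD//.
    by rewrite mulr_ge0// invr_ge0 ltW.
  by rewrite -mulrA ler_wpM2l.
rewrite (le_trans c0x)// mulrC lerDl mulr_ge0// mulr_ge0// addr_ge0//.
by rewrite divr_ge0// ltW.
Qed.

Lemma finite_dimensional_coef : finite_dimensional [set: V] ->
  exists n (b : 'I_n -> V) (K : R) (c : V -> 'I_n -> R), 0 <= K /\
    forall x, x = \sum_i c x i *: b i /\ forall i, `|c x i| <= K * `|x|.
Proof.
move=> [n [b [_ hspan]]]; have [K K0 bK] := coef_bound_exists b.
have /choice[c Hc] : forall x, exists c, x = span b c /\ forall i, `|c i| <= K * `|x|.
  move=> x; have [c xE] := hspan x I; have [c' cc' c'K] := bK c.
  by exists c'; rewrite -cc' xE.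
by exists n, b, K, c.
Qed.

(** Along an ultrafilter on the ball the coefficients converge, hence so do the
    vectors. *)
Lemma finite_dimensional_compact_ball (x : V) (r : R) :
  finite_dimensional [set: V] -> compact [set y : V | `|x - y| <= r].
Proof.
move=> /finite_dimensional_coef[n [b [K [c [K0 Hc]]]]].
rewrite compact_ultra => F ultF Fball.
have [|l cl] := @ultra_comb_cvg _ F n b (fun i y => c y i) (K * (`|x| + r)) ultF.
  move=> i; apply: filterS Fball => y /= xy.
  have [_ /(_ i)/le_trans] := Hc y; apply; rewrite ler_wpM2l//.
  have : `|y| - `|x| <= `|x - y| by rewrite distrC lerB_dist.
  lra.
have Fl : F --> span b l.
  apply: cvg_trans cl; rewrite (_ : (fun y => _) = id) //.
  by apply/funext => y; have [] := Hc y.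
exists (span b l); split => //=.
have : `|x - y| @[y --> F] --> `|x - span b l|.
  by apply: cvg_norm; apply: cvgB; [exact: cvg_cst|exact: Fl].
by move=> /cvgr_to_le; apply.
Qed.

(** Riesz: a finite [1/2]-net of the unit ball spans, since approximating and
    rescaling the error halves it at each round. *)
Lemma compact_ball_finite_dimensional :
  compact [set y : V | `|0 - y| <= 1] -> finite_dimensional [set: V].
Proof.
rewrite compact_cover => /(_ V setT (fun y => ball y (2^-1 : R))).
case=> [y _||D _ Dcover]; first exact: ball_open.
  by move=> y _; exists y => //; exact: ballxx.
pose n := #|{: D}|; pose b (i : 'I_n) : V := val (enum_val i).
have net y : `|y| <= 1 -> exists i, `|y - b i| < 2^-1.
  move=> y1; have [z /= zD] : (\bigcup_(i in [set` D]) ball i (2^-1 : R)) y.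
    by apply: Dcover; rewrite /= sub0r normrN.
  rewrite -ball_normE /= => zy; exists (enum_rank [` zD]%fset).
  by rewrite /b enum_rankK /= distrC.
have [K K0 bK] := coef_bound_exists b.
exists n, b; split=> // x _; apply: (span_closed K0 bK) => e e0.
have approx k : exists c, `|x - span b c| <= `|x| / 2 ^+ k.
  elim: k => [|k [c xc]].
    exists (fun=> 0); rewrite /span big1 => [|i _]; last by rewrite scale0r.
    by rewrite subr0 expr0 divr1.
  pose s := `|x| / 2 ^+ k.
  have := normr_ge0 x; rewrite le_eqVlt => /predU1P[x0|x0].
    by exists c; move: xc; rewrite -x0 !mul0r.
  have s0 : 0 < s by rewrite divr_gt0// exprn_gt0.
  have [|i xi] := net (s^-1 *: (x - span b c)).
    by rewrite normrZ gtr0_norm ?invr_gt0// ler_pdivrMl// mulr1.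
  exists (fun j => c j + s * (j == i)%:R).
  have -> : span b (fun j => c j + s * (j == i)%:R) = span b c + s *: b i.
    rewrite /span; under eq_bigr do rewrite scalerDl.
    rewrite big_split /=; congr (_ + _); rewrite (bigD1 i)//= eqxx mulr1.
    by rewrite big1 ?addr0// => j /negPf ->; rewrite mulr0 scale0r.
  have -> : x - (span b c + s *: b i) = s *: (s^-1 *: (x - span b c) - b i).
    by rewrite scalerBr scalerA divff ?gt_eqF// scale1r opprD addrA.
  have -> : `|x| / 2 ^+ k.+1 = s * 2^-1.
    by rewrite /s exprS; field; rewrite expf_neq0.
  by rewrite normrZ (gtr0_norm s0) ler_pM2l// ltW.
have q0 : 0 <= `|x| / e by rewrite divr_ge0// ltW.
have := archi_boundP q0; set k := Num.bound _ => xk.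
have [c xc] := approx k; exists c; apply: (le_lt_trans xc).
have k2 : k%:R < 2 ^+ k :> R by rewrite -natrX ltr_nat ltn_expl.
rewrite ltr_pdivrMr ?exprn_gt0// mulrC -ltr_pdivrMr//.
exact: lt_trans k2.
Qed.

End finite_dimension.

(** * Magnitude *)

Section magnitude_facts.
Context (R : realType).

Lemma quad_mxE n (A : 'M[R]_n) (v : 'cV[R]_n) :
  (v^T *m A *m v) ord0 ord0 = \sum_i \sum_j v i 0 * v j 0 * A i j.
Proof.
rewrite mxE exchange_big /=; apply: eq_bigr => j _; rewrite mxE mulr_suml.
by apply: eq_bigr => i _; rewrite !mxE; ring.
Qed.

Lemma posdefmx_unit n (A : 'M[R]_n) : posdefmx A -> A \in unitmx.
Proof.
move=> [_ Apos]; rewrite -row_free_unit -kermx_eq0; apply/eqP/row_matrixP => i.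
rewrite row0; apply/eqP; apply: contraT => u0.
have := Apos (row i (kermx A))^T; rewrite trmxK -row_mul mulmx_ker row0 mul0mx mxE ltxx.
by apply; apply: contraNN u0 => /eqP uT; rewrite -[row i _]trmxK uT trmx0.
Qed.

Variable M : metricType R.

Lemma mdist_enum_val_gt0 (F : {fset M}) (i j : 'I_#|{: F}|) : i != j ->
  0 < mdist (val (enum_val i)) (val (enum_val j)).
Proof.
by move=> ij; rewrite mdist_gt0 (inj_eq val_inj) (inj_eq enum_val_inj).
Qed.

Lemma psd_multiplier_posdef (F : {fset M}) (B : R) :
  psd_multiplier (fun i j : 'I_#|{: F}| =>
    B - mdist (val (enum_val i)) (val (enum_val j))) ->
  posdefmx (similarity_mx F).
Proof.
move=> hB; split; first by apply/matrixP => i j; rewrite !mxE metric_sym.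
move=> v v0; rewrite quad_mxE; under eq_bigr do under eq_bigr do rewrite mxE.
apply: (@quad_exp_gt0 _ _ B (fun i j : 'I_#|{: F}| =>
    mdist (val (enum_val i)) (val (enum_val j))) _ id (fun i => v i 0)) => //.
- by move=> i; exact: mdistxx.
- by move=> i j; exact: mdist_enum_val_gt0.
apply: contrapT => nv; move/eqP: v0; apply; apply/colP => i; rewrite mxE.
by apply: contrapT => vi; apply: nv; exists i; apply/eqP.
Qed.

(** With [v] the weighting [Z^-1 1], both the total mass of [v] and its
    quadratic form equal the magnitude. *)
Lemma fset_magnitude_le (F : {fset M}) (B : R) :
  psd_multiplier (fun i j : 'I_#|{: F}| =>
    B - mdist (val (enum_val i)) (val (enum_val j))) ->
  fset_magnitude F <= expR B.
Proof.
move=> hB; set Z := similarity_mx F.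
have ZU : Z \in unitmx by exact/posdefmx_unit/(psd_multiplier_posdef hB).
pose one : 'cV[R]_#|{: F}| := const_mx 1.
pose v := invmx Z *m one.
have Zv : Z *m v = one by rewrite mulKVmx.
have vE : fset_magnitude F = \sum_i v i 0.
  apply: eq_bigr => i _; rewrite mxE; apply: eq_bigr => j _.
  by rewrite [one _ _]mxE mulr1.
have quadE : \sum_i \sum_j v i 0 * v j 0 *
    expR (- mdist (val (enum_val i)) (val (enum_val j))) = fset_magnitude F.
  transitivity ((v^T *m Z *m v) ord0 ord0).
    rewrite quad_mxE; apply: eq_bigr => i _; apply: eq_bigr => j _.
    by rewrite /Z [similarity_mx _ _ _]mxE.
  rewrite -mulmxA Zv mxE vE; apply: eq_bigr => i _.
  by rewrite [one _ _]mxE mulr1 mxE.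
have := sqr_sum_le_quad_exp id (fun i => v i 0) hB; rewrite quadE -vE.
have [m0|m0] := ltP 0 (fset_magnitude F); last first.
  by move=> _; rewrite (le_trans m0)// expR_ge0.
by rewrite expr2 ler_pM2r.
Qed.

Lemma magnitude_lty (K : set M) (B : R) :
  (forall F : {fset M}, [set` F] `<=` K ->
    psd_multiplier (fun i j : 'I_#|{: F}| =>
      B - mdist (val (enum_val i)) (val (enum_val j)))) ->
  (magnitude K < +oo)%E.
Proof.
move=> hB; apply: (@le_lt_trans _ _ (expR B)%:E); last exact: ltry.
apply: ge_ereal_sup => _ [F FK <-]; rewrite lee_fin.
exact/fset_magnitude_le/hB.
Qed.

(** Families with repetitions reduce to their finite set of values by adding up
    the weights of equal points. *)
Lemma positive_definite_psd : positive_definite M ->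
  psd_kernel (fun x y : M => expR (- mdist x y)).
Proof.
move=> pdM I x v.
pose F := [fset x i | i in I]%fset.
have xF i : x i \in F by apply/imfsetP; exists i.
pose k i : 'I_#|{: F}| := enum_rank [` xF i]%fset.
have kE i : val (enum_val (k i)) = x i by rewrite /k enum_rankK.
pose u : 'cV[R]_#|{: F}| := \col_l \sum_(i | k i == l) v i.
have -> : \sum_i \sum_j v i * v j * expR (- mdist (x i) (x j)) =
    (u^T *m similarity_mx F *m u) ord0 ord0.
  rewrite quad_mxE (partition_big k predT)//=; apply: eq_bigr => l _.
  under [RHS]eq_bigr do rewrite !mxE mulr_suml mulr_suml.
  rewrite [RHS]exchange_big /=; apply: eq_bigr => i /eqP kl.
  rewrite (partition_big k predT)//=; apply: eq_bigr => l' _.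
  rewrite mulr_sumr mulr_suml; apply: eq_bigr => j /eqP kl'.
  by rewrite -!kE kl kl'.
have [->|u0] := eqVneq u 0; first by rewrite mulmx0 mxE.
by apply: ltW; have [_ /(_ u u0)] := pdM F.
Qed.

End magnitude_facts.

Section L1_embedded.
Context (R : realType) (M : metricType R).

(** A finite family is dominated by the sum of its absolute values. *)
Lemma psd_multiplier_L1_family (I : finType) (f : I -> L1 R) :
  exists B, psd_multiplier (fun i j : I => B - `|f i - f j|).
Proof.
exists (2 * \int[@lebesgue01 R]_t (\sum_i `|L1fun (f i) t|)).
apply: psd_multiplier_L1dist.
  by apply: rintegrable_sum => i _; exact/rintegrable_norm/L1fun_integrable.
move=> i; apply: aeW => t.
by rewrite (bigD1 i)//= lerDl sumr_ge0.
Qed.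

Lemma isometric_L1_positive_definite (f : M -> normed_metric (L1 R)) :
  isometric_embedding f -> positive_definite M.
Proof.
move=> isof F.
have [B hB] := psd_multiplier_L1_family (fun i : 'I_#|{: F}| =>
  f (val (enum_val i)) : L1 R).
apply: (@psd_multiplier_posdef _ _ F B); move=> H psdH.
by apply: eq_psd_kernel (hB H psdH) => i j; rewrite -isof.
Qed.

End L1_embedded.

Section balls.
Context (R : realType) (V : normedModType R).

Lemma linear_isometry_embedding (phi : {linear V -> L1 R}) :
  (forall x, `|phi x| = `|x|) ->
  isometric_embedding (phi : normed_metric V -> normed_metric (L1 R)).
Proof. by move=> iso x y; rewrite !mdist_norm -linearB iso. Qed.

(** On a ball all coefficients are bounded, so all the functions in play are
    dominated by one integrable function. *)
Lemma ball_magnitude_lty (phi : {linear V -> L1 R}) :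
  (forall x, `|phi x| = `|x|) -> finite_dimensional [set: V] ->
  forall (x : normed_metric V) (r : R), (magnitude (closed_mball x r) < +oo)%E.
Proof.
move=> iso /finite_dimensional_coef[n [b [K [c [K0 Hc]]]]] x r.
pose rho t := K * r * \sum_i `|L1fun (phi (b i)) t|.
have Irho : (@lebesgue01 R).-integrable setT (EFin \o rho).
  apply: rintegrableZ; apply: rintegrable_sum => i _.
  exact/rintegrable_norm/L1fun_integrable.
apply: (@magnitude_lty _ _ _ (2 * \int[@lebesgue01 R]_t rho t)) => F Fball.
pose f (i : 'I_#|{: F}|) : L1 R := phi ((val (enum_val i) : V) - x).
have f_rho i : \forall t \ae @lebesgue01 R, `|L1fun (f i) t| <= rho t.
  pose y : V := (val (enum_val i) : V) - x.
  have yr : `|y| <= r.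
    have := Fball (val (enum_val i)) (valP (enum_val i)).
    by rewrite /closed_mball /= mdist_norm distrC.
  have [yE cy] := Hc y.
  have fE : f i = \sum_j c y j *: phi (b j).
    rewrite /f -/y {1}yE linear_sum; apply: eq_bigr => j _.
    by rewrite linearZ.
  apply: filterS (L1fun_sumZ (index_enum 'I_n) (c y) (phi \o b)) => t.
  rewrite /= -fE => -> //; rewrite (le_trans (ler_norm_sum _ _ _))// /rho mulr_sumr.
  apply: ler_sum => j _; rewrite normrM ler_wpM2r// (le_trans (cy j))//.
  by rewrite ler_wpM2l.
move=> H psdH; apply: eq_psd_kernel (psd_multiplier_L1dist Irho f_rho psdH) => i j.
by rewrite /f -linearB iso mdist_norm opprB addrA subrK.
Qed.

Lemma finite_dimensional_ball_compact (x : normed_metric V) (r : R) :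
  finite_dimensional [set: V] -> compact (closed_mball x r).
Proof. exact: (@finite_dimensional_compact_ball R V x r). Qed.

Lemma positive_definite_embeds :
  finite_dimensional [set: V] -> positive_definite (normed_metric V) ->
  exists phi : {linear V -> L1 R}, forall x, `|phi x| = `|x|.
Proof.
by move=> fdV /positive_definite_psd; exact: negative_type_embeds.
Qed.

End balls.

(** * The equivalence *)

Theorem proposition3p3 (R : realType) (V : normedModType R) :
  [<->
    tractable (normed_metric V);
    finite_dimensional [set: V] /\
      (exists f : normed_metric V -> normed_metric (L1 R),
         isometric_embedding f);
    exists W : set (L1 R),
      [/\ is_subspace W, finite_dimensional W &
        exists phi : {linear V -> L1 R},
          (forall x, `|phi x| = `|x|) /\ set_bij [set: V] W phi];
    [/\ finite_dimensional [set: V], positive_definite (normed_metric V) &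
      forall (x : normed_metric V) (r : R), 0 < r ->
        (magnitude (closed_mball x r) < +oo)%E];
    [/\ finite_dimensional [set: V], positive_definite (normed_metric V) &
      exists (x : normed_metric V) (r : R), 0 < r /\
        (magnitude (closed_mball x r) < +oo)%E]
  ].
Proof.
tfae.
- move=> [pdV balls]; have [cpt _] := balls (0 : V) 1 ltr01.
  have fdV : finite_dimensional [set: V] := compact_ball_finite_dimensional cpt.
  have [phi iso] := positive_definite_embeds fdV pdV.
  by split=> //; exists phi; exact: linear_isometry_embedding.
- move=> [fdV [f /isometric_L1_positive_definite pdV]].
  have [phi iso] := positive_definite_embeds fdV pdV.
  exists (range phi); split.
  + split; first by exists 0 => //; rewrite linear0.
    by move=> a _ _ [x _ <-] [y _ <-]; exists (a *: x + y) => //; rewrite linearP.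
  + have [n [b [_ span]]] := fdV; exists n, (phi \o b); split=> [i|_ [x _ <-]].
      by exists (b i).
    have [c ->] := span x I; exists c.
    by rewrite linear_sum; apply: eq_bigr => i _; rewrite linearZ.
  + exists phi; split=> //; split=> [x _|x y _ _ phixy|y]; first by exists x.
      apply/eqP; rewrite -subr_eq0 -normr_eq0 -iso linearB.
      by rewrite phixy subrr normr0.
    by [].
- move=> [W [_ [n [b [Wb span]]] [phi [iso [funW injW surjW]]]]].
  have /choice[a phia] : forall i, exists a, phi a = b i.
    by move=> i; have [x _ <-] := surjW _ (Wb i); exists x.
  have fdV : finite_dimensional [set: V].
    exists n, a; split=> // x _; have [c phix] := span _ (funW x I).
    exists c; apply: injW; rewrite ?inE// phix linear_sum.
    by apply: eq_bigr => i _; rewrite linearZ -phia.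
  split=> // [|x r _]; last exact: ball_magnitude_lty iso fdV x r.
  exact: isometric_L1_positive_definite (linear_isometry_embedding iso).
- move=> [fdV pdV balls]; split=> //; exists (0 : V), 1.
  by split; [exact: ltr01|exact: balls].
- move=> [fdV pdV _]; split=> // x r _; split.
    exact: finite_dimensional_ball_compact.
  have [phi iso] := positive_definite_embeds fdV pdV.
  exact: ball_magnitude_lty iso fdV x r.
Qed.
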